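(* Let $(H(k))_{k\in\mathbb{Z}}$ and $(V(k))_{k\in\mathbb{Z}}$ be two independent families of i.i.d. positive random variables such that: (i) there exists $c>0$ with $H(x)\ge c$ and $V(x)\ge c$ for all $x\in\mathbb{Z}$; (ii) there exist exponents $\alpha_1,\alpha_2>0$ and constants $c_H,c_V>0$ such that, as $L\to\infty$, $$\mathbb{P}(H(0)>L)=c_HL^{-\alpha_1(1+o(1))},\qquad \mathbb{P}(V(0)>L)=c_VL^{-\alpha_2(1+o(1))}.$$ Set $\varepsilon_i:=\frac12\left(\frac1{\alpha_i}-1\right)\vee0$ for $i=1,2$, and assume $\varepsilon_1\varepsilon_2<1$. Let $a_1,a_2$ be positive constants such that $$a_i>\frac{1+\varepsilon_i}{1-\varepsilon_1\varepsilon_2},\qquad i=1,2,$$ and let $X=(X_1,X_2)$ be the line-model random walk started from $0$. For $T>0$ set $X^{(T)}_i(t)=T^{-a_i/2}X_i(Tt)$, $t\ge0$, $i=1,2$. Then, for $\mathbb{P}$-a.e. environment $\omega$, for all $t>0$ and $i=1,2$, $$\sup_{0\le s\le t}|X^{(T)}_i(s)|\underset{T\to\infty}{\longrightarrow}0\quad\text{in }P^\omega_0\text{-probability}.$$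
   Context: Line model: for a realisation $\omega$ of $(H(k),V(k))_{k\in\mathbb{Z}}$, $X=(X_1,X_2)$ is the continuous-time random walk on $\mathbb{Z}^2$ with generator $\mathcal{L}^\omega f(x)=H(x_2)\,(f(x+e_1)-2f(x)+f(x-e_1))+V(x_1)\,(f(x+e_2)-2f(x)+f(x-e_2))$, $x=(x_1,x_2)\in\mathbb{Z}^2$, $e_1=(1,0)$, $e_2=(0,1)$. $P^\omega_0$ denotes its (quenched) law started from $0$ in the fixed environment $\omega$; $\mathbb{P}$ is the law of the environment. $a\vee b=\max(a,b)$. (Under the stated assumptions the walk is $\mathbb{P}$-a.s. non-explosive.) *)

(* Defs.v *)
From HB Require Import structures.
From mathcomp Require Import all_boot all_order all_algebra.
From mathcomp Require Import all_classical all_reals all_analysis.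

Set Implicit Arguments.
Unset Strict Implicit.
Unset Printing Implicit Defensive.

Import Order.TTheory GRing.Theory Num.Theory.
Import numFieldNormedType.Exports.

Local Open Scope classical_set_scope.
Local Open Scope ring_scope.

Section Independence.
Context (R : realType) (d : measure_display) (Omega : measurableType d).
Variable P : probability Omega R.

Definition mutually_independent (I : eqType) (Z : I -> {RV P >-> R}) : Prop :=
  forall (s : seq I) (B : I -> set R), uniq s ->
    (forall i, measurable (B i)) ->
    P (\bigcap_(i in [set` s]) (Z i @^-1` B i)) =
    (\prod_(i <- s) P (Z i @^-1` B i))%E.

Definition identically_distributed (I : Type) (Z : I -> {RV P >-> R}) : Prop :=
  forall (i j : I) (B : set R), measurable B ->
    distribution P (Z i) B = distribution P (Z j) B.

Definition iid (I : eqType) (Z : I -> {RV P >-> R}) : Prop :=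
  mutually_independent Z /\ identically_distributed Z.

Definition sigma_of_family (I : Type) (Z : I -> {RV P >-> R}) :
    set (set Omega) :=
  <<s [set A | exists i, exists2 B : set R, measurable B & A = Z i @^-1` B] >>.

Definition independent_families (I J : Type)
    (Y : I -> {RV P >-> R}) (Z : J -> {RV P >-> R}) : Prop :=
  forall A B, sigma_of_family Y A -> sigma_of_family Z B ->
    P (A `&` B) = (P A * P B)%E.

(* P(Z > L) = C L^(-alpha (1 + o(1))) as L -> +oo *)
Definition regular_tail (Z : {RV P >-> R}) (C alpha : R) : Prop :=
  exists2 o : R -> R, o L @[L --> +oo] --> (0 : R) &
    \forall L \near +oo,
      P [set w | L < Z w] = (C * L `^ (- (alpha * (1 + o L))))%:E.

Definition cvg_in_probability0 (Z : R -> Omega -> \bar R) : Prop :=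
  forall eta : R, 0 < eta ->
    P [set w | (eta%:E < `| Z T w |)%E] @[T --> +oo] --> (0%R%:E : \bar R).

End Independence.

Section MarkovChain.
Context (R : realType) (S : eqType).
Variable L : (S -> R) -> S -> R.

Definition jump_rate (x y : S) : R := L (fun z => (z == y)%:R) x.

Definition exit_rate (x : S) : R := - jump_rate x x.

Definition jump_prob (x y : S) : R :=
  if y == x then 0 else jump_rate x y / exit_rate x.

Context (d : measure_display) (Omega : measurableType d).
Variable Q : probability Omega R.

(* The joint law of a chain with jump probabilities [jump_prob], started at
   [x0], and of holding times which, given the chain, are independent and
   exponential with parameters [exit_rate (Y k)].  All exit rates are assumed
   to be positive (no absorbing state). *)
Definition jump_hold_law (x0 : S) (Y : nat -> Omega -> S)
    (tau : nat -> Omega -> R) : Prop :=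
  forall (n : nat) (x : nat -> S) (s : nat -> R), (forall k, 0 <= s k) ->
    Q [set w | forall k, (k <= n)%N -> Y k w = x k /\ s k < tau k w] =
    ((x 0%N == x0)%:R
     * \prod_(k < n) jump_prob (x k) (x k.+1)
     * \prod_(k < n.+1) expR (- (exit_rate (x k) * s k)))%:E.

Definition jump_time (tau : nat -> Omega -> R) (n : nat) (w : Omega) : R :=
  \sum_(k < n) tau k w.

(* [X] is a continuous-time Markov chain with generator [L] started from [x0].
   After a possible explosion time, i.e. the limit of the jump times, the path
   is set to [x0]; non-explosion is not part of the definition. *)
Definition is_ctmc (x0 : S) (X : R -> Omega -> S) : Prop :=
  exists (Y : nat -> Omega -> S) (tau : nat -> Omega -> R),
    [/\ (forall n x, measurable [set w | Y n w = x]),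
        (forall n, measurable_fun setT (tau n)),
        (forall n w, 0 < tau n w),
        jump_hold_law x0 Y tau
      & forall t w, 0 <= t ->
          (forall n, jump_time tau n w <= t < jump_time tau n.+1 w ->
             X t w = Y n w)
          /\ ((forall n, jump_time tau n w <= t) -> X t w = x0)].

End MarkovChain.

Section LineModel.
Context (R : realType).

Definition line_generator (H V : int -> R) (f : int * int -> R)
    (x : int * int) : R :=
  H x.2 * (f (x.1 + 1, x.2) - 2 * f x + f (x.1 - 1, x.2))
  + V x.1 * (f (x.1, x.2 + 1) - 2 * f x + f (x.1, x.2 - 1)).

Definition epsilon (alpha : R) : R :=
  Num.max (2^-1 * (alpha^-1 - 1)) 0.

Definition rescaled (Omega : Type) (a : R) (Xi : R -> Omega -> int)
    (T t : R) (w : Omega) : R :=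
  T `^ (- (a / 2)) * (Xi (T * t) w)%:~R.

(* The supremum is taken in the extended reals, so that it is +oo on an
   unbounded path. *)
Definition sup_abs (Omega : Type) (Z : R -> Omega -> R) (t : R) (w : Omega) :
    \bar R :=
  ereal_sup [set `| Z s w |%:E | s in `[0, t]].

End LineModel.

(* Main.v *)
(** Let [L] be the generator and [T = 2 ^ k].  If [g >= 0] satisfies
    [L g <= g / T] on a box and [g >= 1] outside of it, then
    [exp (- s / T) g (X s)] is a supermartingale until the exit from the box, so
    that the walk leaves the box before time [t T] with probability at most
    [exp t * g 0].

    Take the box of half-sides [T ^ (b1 / 2)], [T ^ (b2 / 2)], with [b1 < a1] and
    [b2 < a2], and [g x = x1 ^ 2 / T ^ b1 + x2 ^ 2 / T ^ b2 + phi x], where [phi]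
    is the [1 / T]-potential, in the environment truncated at levels [M1], [M2],
    of the speed of the quadratic part.  The environment seen from the particle is
    stationary because the lattice Laplacians are symmetric and a horizontal
    (vertical) jump rate does not change under horizontal (vertical) shifts; hence
    [E (phi 0)] is at most [T] times the mean speed,
    [2 (E (min H M1) / T ^ b1 + E (min V M2) / T ^ b2)].

    A moment of order [beta1] slightly below [min (alpha1, 1)] gives
    [E (min H M1) <= C M1 ^ (1 - beta1)], and no [H] on the box exceeds
    [M1 = T ^ (b2 / (2 beta1) + theta)] up to a probability [T ^ (- kappa)]; the
    condition on [a1], [a2] is what makes [1 + eps1 b2 < b1] and
    [1 + eps2 b1 < b2] solvable.  Both errors are summable along [T = 2 ^ k]. *)
Require Import Defs.
From HB Require Import structures.
From mathcomp Require Import all_boot all_order all_algebra.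
From mathcomp Require Import all_classical all_reals all_analysis.
From mathcomp Require Import measurable_realfun zify ring lra.

Import Order.TTheory GRing.Theory Num.Theory.
Import numFieldNormedType.Exports.

Local Open Scope classical_set_scope.
Local Open Scope ring_scope.

(** * Chains with exponential holding times *)

Section HoldingTimes.
Context (R : realType) (d : measure_display) (T : measurableType d).
Variable Q : {finite_measure set T -> \bar R}.
Local Notation mu := (@lebesgue_measure R).

Lemma integral_exponential_pdf_lt (lambda x : R) : 0 < lambda -> 0 < x ->
  (\int[mu]_s (exponential_pdf lambda s * (s < x)%R%:R)%R%:E =
   (1 - expR (- lambda * x))%R%:E)%E.
Proof.
move=> l0 x0; rewrite EFinB -(exponential_prob_itv0c lambda x0).
rewrite /exponential_prob -(@integral_itv_bndo_bndc R (BLeft 0%R) x); last first.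
  apply/measurable_EFinP; apply: (@measurable_funS _ _ _ _ setT) => //.
  exact: measurable_exponential_pdf.
rewrite [RHS]integral_mkcond; apply: eq_integral => s _.
rewrite patchE; case: ifPn => [|/negP].
  by rewrite inE /= in_itv/= => /andP[_ ->]; rewrite mulr1.
rewrite inE /= in_itv/= => /negP; rewrite negb_and -ltNge => /orP[s0|/negbTE ->].
  by rewrite lt0_exponential_pdf// mul0r.
by rewrite mulr0.
Qed.

(** Exponential tilting: the integrand is [lambda / (lambda + r)] times the exponential density of
    parameter [lambda + r]. *)
Lemma integral_exponential_pdf_expR (lambda r : R) : 0 < lambda -> 0 < r ->
  (\int[mu]_s (exponential_pdf lambda s * expR (- (r * s)))%R%:E =
   (lambda / (lambda + r))%R%:E)%E.
Proof.
move=> l0 r0; have lr0 : 0 < lambda + r by rewrite addr_gt0.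
rewrite -[RHS]mule1 -(integral_exponential_pdf lr0) -ge0_integralZl//=.
- apply: eq_integral => s _; rewrite -EFinM; congr EFin.
  have [s0|s0] := ltP s 0; first by rewrite !lt0_exponential_pdf// mul0r mulr0.
  rewrite !exponential_pdfE// mulrA divfK ?gt_eqF// -mulrA -expRD.
  by congr (_ * expR _); ring.
- by apply/measurable_EFinP; exact: measurable_exponential_pdf.
- by move=> s _; rewrite lee_fin exponential_pdf_ge0// ltW.
- by rewrite lee_fin divr_ge0// ltW.
Qed.

(* Tonelli, after writing [1 - expR (- (lambda * tau w))] as the integral of the
   density [exponential_pdf lambda] over [s < tau w]. *)
Lemma laplace_exponential_tail (W tau : T -> R) (lambda r c : R) :
  0 < lambda -> 0 < r ->
  measurable_fun setT W -> (forall w, 0 <= W w) ->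
  measurable_fun setT tau -> (forall w, 0 < tau w) ->
  (forall s : R, (0 <= s)%R ->
    \int[Q]_w (W w * (s < tau w)%R%:R)%R%:E = (c * expR (- (r * s)))%R%:E)%E ->
  (\int[Q]_w (W w * expR (- (lambda * tau w)))%R%:E =
   (c * (r / (r + lambda)))%R%:E)%E.
Proof.
move=> l0 r0 mW W0 mtau tau0 tail.
have mexp : measurable_fun setT (fun w => expR (- (lambda * tau w))).
  apply: measurableT_comp => //; apply: measurableT_comp => //.
  exact: measurable_funM.
have totW : (\int[Q]_w (W w)%R%:E = c%:E)%E.
  have := tail 0 (lexx _); rewrite mulr0 oppr0 expR0 mulr1 => <-.
  by apply: eq_integral => w _; rewrite tau0 mulr1.
have e1 w : expR (- (lambda * tau w)) <= 1.
  by rewrite -expR0 ler_expR oppr_le0 mulr_ge0 ?ltW.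
have split : (\int[Q]_w (W w * expR (- (lambda * tau w)))%R%:E +
  \int[Q]_w (W w * (1 - expR (- (lambda * tau w))))%R%:E = c%:E)%E.
  rewrite -ge0_integralD//; first last.
  - by apply/measurable_EFinP/measurable_funM => //; exact: measurable_funB.
  - by move=> w _; rewrite lee_fin mulr_ge0// subr_ge0.
  - by apply/measurable_EFinP/measurable_funM.
  - by move=> w _; rewrite lee_fin mulr_ge0// expR_ge0.
  by rewrite -totW; apply: eq_integral => w _; rewrite -EFinD; congr EFin; ring.
have compl : (\int[Q]_w (W w * (1 - expR (- (lambda * tau w))))%R%:E =
   (c * (lambda / (lambda + r)))%R%:E)%E.
  pose f (z : T * R) : \bar R :=
    (W z.1 * (z.2 < tau z.1)%R%:R * exponential_pdf lambda z.2)%R%:E.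
  have pdf0 s : 0 <= exponential_pdf lambda s by exact/exponential_pdf_ge0/ltW.
  have mf : measurable_fun setT f.
    apply/measurable_EFinP; apply: measurable_funM; last first.
      by apply: measurableT_comp => //; exact: measurable_exponential_pdf.
    apply: measurable_funM; first exact: measurableT_comp.
    apply: measurableT_comp => //; apply: measurable_fun_ltr => //.
    exact: measurableT_comp.
  have f0 z : (0 <= f z)%E by rewrite lee_fin !mulr_ge0.
  have -> : (\int[Q]_w (W w * (1 - expR (- (lambda * tau w))))%R%:E =
             \int[Q]_w \int[mu]_s f (w, s))%E.
    apply: eq_integral => w _.
    rewrite -mulNr EFinM -integral_exponential_pdf_lt// -ge0_integralZl//=.
    - by apply: eq_integral => s _; rewrite /f/= -EFinM; congr EFin; ring.
    - apply/measurable_EFinP/measurable_funM.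
        exact: measurable_exponential_pdf.
      by apply: measurableT_comp => //; exact: measurable_fun_ltr.
    - by move=> s _; rewrite lee_fin mulr_ge0.
    - by rewrite lee_fin.
  etransitivity; first exact: (@fubini_tonelli _ _ _ _ _ Q mu f mf f0).
  have c0 : 0 <= c.
    by rewrite -lee_fin -totW integral_ge0// => w _; rewrite lee_fin.
  rewrite EFinM -integral_exponential_pdf_expR// -ge0_integralZl//=; last 2 first.
  - apply/measurable_EFinP/measurable_funM.
      exact: measurable_exponential_pdf.
    by do 2 apply: measurableT_comp => //; exact: measurable_funM.
  - by move=> s _; rewrite lee_fin mulr_ge0// expR_ge0.
  apply: eq_integral => s _; have [s0|s0] := ltP s 0.
    rewrite lt0_exponential_pdf// mul0r mule0 integral0_eq// => w _.
    by rewrite /f/= lt0_exponential_pdf// mulr0.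
  rewrite /f /=; under eq_integral do rewrite EFinM muleC.
  rewrite ge0_integralZl//=; last 3 first.
  - apply/measurable_EFinP/measurable_funM => //.
    by apply: measurableT_comp => //; exact: measurable_fun_ltr.
  - by move=> w _; rewrite lee_fin mulr_ge0.
  - by rewrite lee_fin.
  by rewrite tail// -!EFinM; congr EFin; ring.
(* The unknown integral is an extended real; since its sum with a real number is real, both
   infinities are ruled out and [compl] can be subtracted. *)
move: split; rewrite compl; move: (integral Q setT _) => -[i| |] //= [] h.
congr EFin; apply: (addIr (c * (lambda / (lambda + r)))); rewrite h.
by field; rewrite !gt_eqF// ?addr_gt0.
Qed.

End HoldingTimes.

(** * Exit from a set for a jump chain with exponential holding times *)

Section JumpChain.
Context (R : realType) (S : countType) (L : (S -> R) -> S -> R).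
Context (d : measure_display) (T : measurableType d) (Q : probability T R).
Context (x0 : S) (Y : nat -> T -> S) (tau : nat -> T -> R) (lambda : R).
Hypotheses (lambda_gt0 : 0 < lambda) (rate_gt0 : forall x, 0 < exit_rate L x).
Hypotheses (mY : forall n x, measurable [set w | Y n w = x])
  (mtau : forall n, measurable_fun setT (tau n))
  (tau_gt0 : forall n w, 0 < tau n w)
  (law : jump_hold_law L Q x0 Y tau).

Let holding_set n (x : nat -> S) m (s : nat -> R) :=
  [set w | forall k, (k <= n)%N ->
     Y k w = x k /\ ((m <= k)%N -> s k < tau k w)].

Let path_weight n (x : nat -> S) : R :=
  (x 0%N == x0)%:R * \prod_(k < n) jump_prob L (x k) (x k.+1).

Lemma measurable_holding_set n x m s : measurable (holding_set n x m s).
Proof.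
rewrite (_ : holding_set n x m s = \bigcap_(k in [set k | (k <= n)%N])
   ([set w | Y k w = x k] `&`
    (if (m <= k)%N then [set w | s k < tau k w] else setT))); last first.
  apply/seteqP; split=> w /= h k /= kn.
    by have [-> st] := h k kn; split => //; case: ifP => // mk; exact: st.
  by have [/= -> +] := h k kn; split => // mk; move: b; rewrite mk.
apply: bigcap_measurable; first by exists 0%N.
move=> k _; apply: measurableI => //; case: ifP => // _.
have := @measurable_fun_ltr _ _ _ setT (fun=> s k) (tau k).
move=> /(_ _ (mtau k)) /(_ _) h.
have /h := measurable_cst (s k) : measurable_fun [set: T] (fun=> s k).
move=> /(_ measurableT [set true]); rewrite setTI => /(_ _); apply => //.
Qed.

(* The first [m] holding times are integrated against the exponential weight while
   the others are only constrained by their tails, the form in which the joint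
   law is given. *)
Lemma laplace_holding_set n x m (s : nat -> R) :
  (m <= n.+1)%N -> (forall k, 0 <= s k) ->
  (\int[Q]_w (\prod_(k < m) expR (- (lambda * tau k w))
              * \1_(holding_set n x m s) w)%R%:E =
   (path_weight n x
    * \prod_(k < m) (exit_rate L (x k) / (exit_rate L (x k) + lambda))
    * \prod_(m <= k < n.+1) expR (- (exit_rate L (x k) * s k)))%R%:E)%E.
Proof.
elim: m s => [|m IH] s mn s0.
  rewrite big_ord0 mulr1 big_mkord /path_weight -(law n x s s0).
  under eq_integral do rewrite big_ord0 mul1r.
  rewrite integral_indic ?setIT//; last exact: measurable_holding_set.
  by congr (Q _); apply/seteqP; split=> w /= h k kn; have [? ?] := h k kn;
    split => //; auto.
under eq_integral do rewrite big_ord_recr /= mulrAC.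
rewrite big_ord_recr /= mulrA [X in (X)%:E](_ : _ =
   path_weight n x * (\prod_(k < m) (exit_rate L (x k) / (exit_rate L (x k) + lambda)))
   * \prod_(m.+1 <= k < n.+1) expR (- (exit_rate L (x k) * s k))
   * (exit_rate L (x m) / (exit_rate L (x m) + lambda))); last by ring.
apply: (@laplace_exponential_tail R d T Q
  (fun w => \prod_(k < m) expR (- (lambda * tau k w)) *
     \1_(holding_set n x m.+1 s) w)) => //.
- apply: measurable_funM; last exact/measurable_indic/measurable_holding_set.
  apply: measurable_prod => k _; apply: measurableT_comp => //.
  by apply: measurableT_comp => //; exact: measurable_funM.
- by move=> w; rewrite mulr_ge0// prodr_ge0// => k _; exact: expR_ge0.
(* The bound on [tau m] becomes the threshold [u] at index [m], so that the induction hypothesis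
   applies to [s']. *)
move=> u u0; pose s' k := if k == m then u else s k.
have s'0 k : 0 <= s' k by rewrite /s'; case: ifP.
have -> : (\int[Q]_w (\prod_(k < m) expR (- (lambda * tau k w))
   * \1_(holding_set n x m.+1 s) w * (u < tau m w)%R%:R)%R%:E =
  \int[Q]_w (\prod_(k < m) expR (- (lambda * tau k w))
              * \1_(holding_set n x m s') w)%R%:E)%E.
  apply: eq_integral => w _; congr EFin; rewrite -mulrA; congr (_ * _).
  rewrite !indicE -natrM mulnb; congr ((nat_of_bool _)%:R).
  apply/andP/idP; rewrite !inE.
    move=> -[h um] k kn; have [Yk sk] := h k kn; split => //.
    rewrite /s'; case: eqP => [->//|/eqP km mk]; apply: sk.
    by rewrite ltn_neqAle eq_sym km.
  move=> h; split; last first.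
    by have [_ /(_ (leqnn m))] := h m mn; rewrite /s' eqxx.
  move=> k kn; have [Yk sk] := h k kn; split => // mk.
  by have := sk (ltnW mk); rewrite /s' gtn_eqF.
rewrite IH//; last exact: ltnW.
rewrite (@big_ltn _ _ _ m n.+1)// /s' eqxx.
rewrite (@eq_big_nat _ _ _ m.+1 n.+1 _
  (fun k => expR (- (exit_rate L (x k) * s k)))); last first.
  by move=> k /andP[mk _]; rewrite gtn_eqF.
by congr EFin; ring.
Qed.

(** Expectation of [expR (- (lambda * jump_time tau n w))] on the event that the chain follows [x]
    up to step [n]: every jump contributes its probability and the Laplace transform of one
    exponential holding time. *)
Let laplace_weight n (x : nat -> S) : R :=
  (x 0%N == x0)%:R * \prod_(k < n) (jump_prob L (x k) (x k.+1) *
     (exit_rate L (x k) / (exit_rate L (x k) + lambda))).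

Lemma measurable_jump_time n : measurable_fun setT (jump_time tau n).
Proof. by apply: measurable_sum => k. Qed.

Lemma measurable_bigcup_countType (F : S -> set T) (A : set S) :
  (forall y, measurable (F y)) -> measurable (\bigcup_(y in A) F y).
Proof.
move=> mF; rewrite bigcup_mkcond; apply: countable_bigcupT_measurable.
  exact: countableP.
by move=> y; case: ifP.
Qed.

Lemma measurable_state n (A : set S) : measurable [set w | A (Y n w)].
Proof.
rewrite (_ : [set _ | _] = \bigcup_(y in A) [set w | Y n w = y]).
  exact: measurable_bigcup_countType.
by apply/seteqP; split=> w /=; [exists (Y n w)|case=> y Ay ->].
Qed.

Lemma measurable_jump_time_le n t : measurable [set w | jump_time tau n w <= t].
Proof.
rewrite [X in measurable X](_ : _ = jump_time tau n @^-1` `]-oo, t]).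
  by rewrite -[X in measurable X]setTI; exact: measurable_jump_time.
by apply/seteqP; split => w /=; rewrite in_itv.
Qed.

Lemma jump_time_le m n w : (m <= n)%N -> jump_time tau m w <= jump_time tau n w.
Proof.
move=> mn; rewrite /jump_time -(subnKC mn) big_split_ord /= lerDl.
by apply: sumr_ge0 => k _; exact: ltW.
Qed.

Let path_set n (x : nat -> S) := [set w | forall k, (k <= n)%N -> Y k w = x k].

Lemma measurable_path_set n x : measurable (path_set n x).
Proof.
rewrite (_ : path_set n x = \bigcap_(k in [set k | (k <= n)%N])
   [set w | Y k w = x k]) //.
by apply: bigcap_measurable => //; exists 0%N.
Qed.

(** Chernoff bound: on the event, [1 <= expR (lambda * (t - jump_time tau n w))], and the
    expectation of the right-hand side along the path is explicit. *)
Lemma path_prob_le n x t :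
  (Q (path_set n x `&` [set w | (jump_time tau n w <= t)%R]) <=
   (expR (lambda * t) * laplace_weight n x)%R%:E)%E.
Proof.
have -> : laplace_weight n x = path_weight n x *
  \prod_(k < n) (exit_rate L (x k) / (exit_rate L (x k) + lambda)).
  by rewrite /laplace_weight big_split/= mulrA.
set A := _ `&` _.
have mA : measurable A.
  by apply: measurableI; [exact: measurable_path_set|exact: measurable_jump_time_le].
(* The holding time at [n] does not enter [jump_time tau n]; it keeps the threshold 0, which is no
   constraint on a positive time. *)
have := @laplace_holding_set n x n (fun=> 0) (leqnSn n) (fun=> lexx 0).
rewrite big_nat1 mulr0 oppr0 expR0 mulr1 => laplace.
rewrite [X in (_ <= X)%E]EFinM -laplace.
have mprod : measurable_fun setT (fun w =>
    \prod_(k < n) expR (- (lambda * tau k w)) *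
    (\1_(holding_set n x n (fun=> 0)) w : R)).
  apply: measurable_funM; last exact/measurable_indic/measurable_holding_set.
  apply: measurable_prod => k _; apply: measurableT_comp => //.
  by apply: measurableT_comp => //; exact: measurable_funM.
rewrite -ge0_integralZl//=; last 2 first.
- exact/measurable_EFinP.
- by move=> w _; rewrite lee_fin mulr_ge0// prodr_ge0// => k _; exact: expR_ge0.
rewrite -[X in Q X]setIT -integral_indic//; apply: ge0_le_integral => //.
- by apply/measurable_EFinP.
- by apply: emeasurable_funM => //; apply/measurable_EFinP.
move=> w _; rewrite lee_fin !indicE; have [|wA] := boolP (w \in A); last first.
  by rewrite !mulr_ge0 ?expR_ge0// prodr_ge0// => k _; exact: expR_ge0.
rewrite inE => -[Yx St]; rewrite mem_set; last first.
  by move=> k kn; split => //; exact: Yx.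
rewrite mulr1 -expR_sum -expRD -[leLHS]expR0 ler_expR sumrN -mulr_sumr -mulrBr.
by rewrite mulr_ge0 ?subr_ge0// ltW.
Qed.

Context (B : set S) (g : S -> R) (nbr : S -> seq S).
Hypotheses (B0 : B x0) (g_ge0 : forall x, 0 <= g x)
  (g_ge1 : forall x, ~ B x -> 1 <= g x)
  (jump_ge0 : forall x y, 0 <= jump_prob L x y)
  (jump_nbr : forall x y, y \notin nbr x -> jump_prob L x y = 0)
  (g_super : forall x, B x ->
     \sum_(y <- nbr x) jump_prob L x y * g y <=
     (exit_rate L x + lambda) / exit_rate L x * g x).

(** The joint law of the path extended by [y], with all thresholds 0, contains the vanishing factor
    [jump_prob L (x n) y]. *)
Lemma path_set_nonnbr n x y :
  y \notin nbr (x n) ->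
  Q (path_set n x `&` [set w | Y n.+1 w = y]) = 0%E.
Proof.
move=> ynb; pose x' k := if (k <= n)%N then x k else y.
have := @law n.+1 x' (fun=> 0) (fun=> lexx 0).
have x'n : x' n = x n by rewrite /x' leqnn.
have x'n1 : x' n.+1 = y by rewrite /x' ltnn.
rewrite big_ord_recr /= x'n x'n1 jump_nbr// !mulr0 mul0r => lw.
apply: etrans lw; congr (Q _); apply/seteqP; split => w /=.
  move=> [h Yn] k; rewrite leq_eqVlt => /predU1P[->|kn]; split => //.
    by rewrite /x' ltnn.
  by rewrite /x' -ltnS kn h.
move=> h; split => [k kn|]; last by have [] := h n.+1 (leqnn _); rewrite /x' ltnn.
by have [] := h k (leqW kn); rewrite /x' kn.
Qed.

(** Supermartingale argument written as an induction on the number [n] of steps left, splitting the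
    event according to the next state [y]. Outside [B] the bound comes from [path_prob_le] and
    [1 <= g y], inside [B] from the induction hypothesis. The sum over [y] closes by [g_super], the
    form taken by [L g <= lambda g] on the jump chain. *)
Lemma exit_prob_step n m x t : B (x m) ->
  (Q [set w | path_set m x w /\ exists j, (0 < j <= n)%N /\
        ~ B (Y (m + j) w) /\ (jump_time tau (m + j) w <= t)%R] <=
   (expR (lambda * t) * laplace_weight m x * g (x m))%R%:E)%E.
Proof.
set E := fun n m x => [set w | path_set m x w /\ exists j, (0 < j <= n)%N /\
        ~ B (Y (m + j) w) /\ (jump_time tau (m + j) w <= t)%R].
rewrite -/(E n m x).
have mE n' m' x' : measurable (E n' m' x').
  rewrite (_ : E n' m' x' = path_set m' x' `&`
    \bigcup_(j in [set j | (0 < j <= n')%N])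
      ([set w | (~` B) (Y (m' + j) w)] `&` [set w | jump_time tau (m' + j) w <= t])).
    apply: measurableI; first exact: measurable_path_set.
    apply: bigcup_measurable => j _; apply: measurableI.
      exact: measurable_state.
    exact: measurable_jump_time_le.
  apply/seteqP; split=> w /= [? [j]].
    by move=> [? [? ?]]; split => //; exists j.
  by move=> ? [? ?]; split => //; exists j.
have lw_ge0 m' x' : 0 <= laplace_weight m' x'.
  rewrite mulr_ge0// prodr_ge0// => k _; rewrite mulr_ge0// divr_ge0//.
    exact: ltW.
  by rewrite ltW// addr_gt0.
have weight_ge0 m' x' : 0 <= expR (lambda * t) * laplace_weight m' x'.
  exact: mulr_ge0 (expR_ge0 _) (lw_ge0 _ _).
elim: n m x => [|n IH] m x Bx.
  rewrite (_ : E 0%N m x = set0) ?measure0; last first.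
    by apply/seteqP; split=> // w [_ [j [/andP[j0]]]]; rewrite leqNgt j0.
  by rewrite lee_fin (mulr_ge0 (weight_ge0 _ _)).
pose x' y k := if (k <= m)%N then x k else y.
have lwS y : laplace_weight m.+1 (x' y) = laplace_weight m x *
    (jump_prob L (x m) y * (exit_rate L (x m) / (exit_rate L (x m) + lambda))).
  rewrite /laplace_weight big_ord_recr /= {1}/x' /= mulrA; congr (_ * _ * _).
    by apply: eq_bigr => k _; rewrite /x' ltn_ord ltnW.
  by rewrite /x' leqnn ltnn.
pose F y := E n.+1 m x `&` [set w | Y m.+1 w = y].
have mF y : measurable (F y) by exact: measurableI.
have FE y : (Q (F y) <=
   (expR (lambda * t) * laplace_weight m.+1 (x' y) * g y)%R%:E)%E.
  have pathS w : F y w -> path_set m.+1 (x' y) w.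
    move=> [[h _] Yy] k; rewrite leq_eqVlt => /predU1P[->|km].
      by rewrite Yy /x' ltnn.
    by rewrite /x' -ltnS km h.
  have [By|nBy] := pselect (B y).
    have gy : g y = g (x' y m.+1) by rewrite /x' ltnn.
    rewrite gy; apply: le_trans (IH m.+1 (x' y) _); last by rewrite /x' ltnn.
    apply: le_measure; rewrite ?inE// => w Fw; split; first exact: pathS.
    have [[_ [j [/andP[j0 jn] [nB Sj]]]] Yy] := Fw.
    case: j j0 jn nB Sj => [//|[_ _|j _ jn nB Sj]].
      by rewrite addn1 Yy.
    by exists j.+1; rewrite addSnnS.
  (* If [y] is outside [B], the exit already happens at step [m.+1], whose jump time is at most that
     of the recorded exit. *)
  apply: (@le_trans _ _ (expR (lambda * t) * laplace_weight m.+1 (x' y))%:E).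
    apply: le_trans (path_prob_le m.+1 (x' y) t).
    apply: le_measure; rewrite ?inE//.
      apply: measurableI; first exact: measurable_path_set.
      exact: measurable_jump_time_le.
    move=> w Fw; split; first exact: pathS.
    have [[_ [j [/andP[j0 jn] [nB Sj]]]] Yy] := Fw.
    by apply: le_trans Sj; apply: jump_time_le; rewrite -addn1 leq_add2l.
  by rewrite lee_fin ler_peMr ?g_ge1.
(* Jumps from [x m] to a non-neighbour form a null set, which reduces the countable union over next
   states to a finite sum over [nbr (x m)]. *)
pose N := \bigcup_(y in [set y | y \notin nbr (x m)])
   (path_set m x `&` [set w | Y m.+1 w = y]).
have mN0 y : measurable (path_set m x `&` [set w | Y m.+1 w = y]).
  by apply: measurableI => //; exact: measurable_path_set.
have mN : measurable N.
  exact: measurable_bigcup_countType.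
have QN : Q N = 0%E.
  apply/negligibleP => //; apply: (@negligibleS _ _ _ _
    (\bigcup_i (if unpickle i is Some y then
       if y \notin nbr (x m) then path_set m x `&` [set w | Y m.+1 w = y] else set0
     else set0))).
    move=> w [y /= yn Pw]; exists (pickle y) => //.
    by rewrite pickleK yn.
  apply: negligible_bigcup => i; case: unpickle => [y|]; last exact: negligible_set0.
  case: ifP => [yn|_]; last exact: negligible_set0.
  by apply/negligibleP => //; exact: path_set_nonnbr.
have EF : E n.+1 m x `<=` \big[setU/set0]_(y <- nbr (x m)) F y `|` N.
  move=> w Ew; have [yn|yn] := boolP (Y m.+1 w \in nbr (x m)); [left|right].
    by rewrite -bigcup_seq; exists (Y m.+1 w).
  by exists (Y m.+1 w) => //; split => //; case: Ew.
have mU : measurable (\big[setU/set0]_(y <- nbr (x m)) F y).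
  by apply: bigsetU_measurable.
apply: (@le_trans _ _ (\sum_(y <- nbr (x m))
   expR (lambda * t) * laplace_weight m.+1 (x' y) * g y)%R%:E).
  apply: (@le_trans _ _ (Q (\big[setU/set0]_(y <- nbr (x m)) F y `|` N))).
    by apply: le_measure; rewrite ?inE//; exact: measurableU.
  rewrite measureU0//.
  elim: (nbr (x m)) => [|y s ih]; first by rewrite !big_nil measure0.
  rewrite !big_cons; apply: le_trans (measureU2 _ _ _) _ => //.
    exact: bigsetU_measurable.
  by rewrite EFinD; apply: leeD; [exact: FE|exact: ih].
rewrite lee_fin.
under eq_bigr => y _ do rewrite lwS.
have r0 := rate_gt0 (x m); have rl : 0 < exit_rate L (x m) + lambda by rewrite addr_gt0.
rewrite (_ : \sum_(y <- _) _ = expR (lambda * t) * laplace_weight m x *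
   (exit_rate L (x m) / (exit_rate L (x m) + lambda)) *
   \sum_(y <- nbr (x m)) jump_prob L (x m) y * g y); last first.
  by rewrite mulr_sumr; apply: eq_bigr => y _; ring.
rewrite -mulrA ler_wpM2l//.
rewrite mulrC -ler_pdivlMr ?divr_gt0// invf_div mulrC.
exact: g_super.
Qed.

(** Continuity from below lets the number of steps in [exit_prob_step] tend to infinity. An exit at
    index 0 is impossible because [x0] lies in [B], up to the null event that the chain does not
    start at [x0]. *)
Lemma exit_prob_le t :
  (Q [set w | exists n, ~ B (Y n w) /\ (jump_time tau n w <= t)%R] <=
   (expR (lambda * t) * g x0)%R%:E)%E.
Proof.
pose E n := [set w | path_set 0 (fun=> x0) w /\ exists j, (0 < j <= n)%N /\
        ~ B (Y (0 + j)%N w) /\ (jump_time tau (0 + j)%N w <= t)%R].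
have mstep j : measurable [set w | ~ B (Y j w) /\ jump_time tau j w <= t].
  apply: (@measurableI _ _ [set w | (~` B) (Y j w)]).
    exact: measurable_state.
  exact: measurable_jump_time_le.
have mE n : measurable (E n).
  rewrite (_ : E n = path_set 0 (fun=> x0) `&`
    \bigcup_(j in [set j | (0 < j <= n)%N])
      [set w | ~ B (Y j w) /\ jump_time tau j w <= t]).
    apply: measurableI; first exact: measurable_path_set.
    exact: bigcup_measurable.
  apply/seteqP; split=> w /= [h [j]].
    by move=> [jn ?]; split => //; exists j.
  by move=> jn ?; split => //; exists j.
pose N := [set w | Y 0%N w <> x0].
have mN : measurable N by exact: (@measurable_state 0 [set x | x <> x0]).
have QN : Q N = 0%E.
  rewrite (_ : N = ~` [set w | Y 0%N w = x0])// probability_setC//.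
  rewrite (_ : [set w | Y 0%N w = x0] = [set w | forall k, (k <= 0)%N ->
     Y k w = x0 /\ 0 < tau k w]); last first.
    apply/seteqP; split=> w /=; last by move=> /(_ 0%N (leqnn _))[].
    by move=> h [|//] _.
  rewrite (@law 0%N (fun=> x0) (fun=> 0))// eqxx big_ord0 big_ord_recl big_ord0.
  by rewrite mulr0 oppr0 expR0 !mulr1 -EFinB subrr.
have mUE : measurable (\bigcup_n E n) by exact: bigcupT_measurable.
have mA : measurable [set w | exists n, ~ B (Y n w) /\ jump_time tau n w <= t].
  rewrite (_ : [set _ | _] =
     \bigcup_n [set w | ~ B (Y n w) /\ jump_time tau n w <= t]).
    exact: bigcupT_measurable.
  by apply/seteqP; split=> w /= [n]; exists n.
apply: (@le_trans _ _ (Q (\bigcup_n E n `|` N))).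
  apply: le_measure; rewrite ?inE//; first exact: measurableU.
  move=> w /= [n [nB Sn]].
  have [Y0|] := pselect (Y 0%N w = x0); [left|by right].
  case: n nB Sn => [|n] nB Sn; first by rewrite Y0 in nB.
  exists n.+1 => //; split; last by exists n.+1; rewrite !add0n leqnn.
  by move=> [|//] _.
rewrite measureU0//.
have ndE : nondecreasing_seq E.
  move=> n m nm; apply/subsetPset => w [h [j [/andP[j0 jn] ?]]]; split => //.
  by exists j; rewrite j0 (leq_trans jn).
have cE : (Q \o E) n @[n --> \oo] --> Q (\bigcup_n E n) by exact: nondecreasing_cvg_mu.
suff : (limn (Q \o E) <= (expR (lambda * t) * g x0)%R%:E)%E by rewrite (cvg_lim _ cE).
apply: lime_le; first by apply/cvg_ex; eexists; exact: cE.
apply: nearW => n /=; apply: le_trans (@exit_prob_step n 0 (fun=> x0) t B0) _.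
by rewrite /laplace_weight big_ord0 eqxx !mulr1.
Qed.

End JumpChain.

(** * The line model in a fixed environment *)

Section LineChain.
Context (R : realType) (H V : int -> R).
Hypotheses (H_gt0 : forall k, 0 < H k) (V_gt0 : forall k, 0 < V k).
Local Notation L := (line_generator H V).

Definition line_nbr (x : int * int) : seq (int * int) :=
  [:: (x.1 + 1, x.2); (x.1 - 1, x.2); (x.1, x.2 + 1); (x.1, x.2 - 1)].

Lemma line_exit_rate x : exit_rate L x = 2 * (H x.2 + V x.1).
Proof.
case: x => i j; rewrite /exit_rate /jump_rate /line_generator /= !xpair_eqE !eqxx.
have -> : (i + 1 == i) = false by apply/negbTE/eqP; lia.
have -> : (i - 1 == i) = false by apply/negbTE/eqP; lia.
have -> : (j + 1 == j) = false by apply/negbTE/eqP; lia.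
have -> : (j - 1 == j) = false by apply/negbTE/eqP; lia.
by rewrite /=; ring.
Qed.

Lemma line_exit_rate_gt0 x : 0 < exit_rate L x.
Proof. by rewrite line_exit_rate mulr_gt0// addr_gt0. Qed.

Lemma line_jump_rate x y : y != x -> jump_rate L x y =
  H x.2 * (((x.1 + 1, x.2) == y)%:R + ((x.1 - 1, x.2) == y)%:R) +
  V x.1 * (((x.1, x.2 + 1) == y)%:R + ((x.1, x.2 - 1) == y)%:R).
Proof.
by rewrite eq_sym => /negbTE yx; rewrite /jump_rate /line_generator yx mulr0 !subr0.
Qed.

Lemma line_jump_prob_ge0 x y : 0 <= jump_prob L x y.
Proof.
rewrite /jump_prob; case: eqP => // /eqP yx.
rewrite divr_ge0 ?(ltW (line_exit_rate_gt0 _))// line_jump_rate//.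
by rewrite addr_ge0// mulr_ge0 ?(ltW (H_gt0 _)) ?(ltW (V_gt0 _))// addr_ge0.
Qed.

Lemma line_jump_prob_nbr x y : y \notin line_nbr x -> jump_prob L x y = 0.
Proof.
rewrite /jump_prob; case: eqP => // /eqP yx.
rewrite !inE !negb_or => /and4P[/negbTE y1 /negbTE y2 /negbTE y3 /negbTE y4].
rewrite line_jump_rate// ![_ == y]eq_sym y1 y2 y3 y4.
by rewrite !addr0 !mulr0 addr0 mul0r.
Qed.

(** Dictionary between generator and jump chain: it turns [L g <= lambda g] into the supermartingale
    condition required by [exit_prob_le]. *)
Lemma sum_line_jump_prob (g : int * int -> R) x :
  \sum_(y <- line_nbr x) jump_prob L x y * g y =
  (L g x + exit_rate L x * g x) / exit_rate L x.
Proof.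
have r0 : exit_rate L x != 0 by rewrite gt_eqF// line_exit_rate_gt0.
case: x r0 => i j r0.
have E y : y != (i, j) ->
  jump_prob L (i, j) y = jump_rate L (i, j) y / exit_rate L (i, j).
  by rewrite /jump_prob => /negbTE ->.
have n1 : (i + 1 == i) = false by apply/negbTE/eqP; lia.
have n2 : (i - 1 == i) = false by apply/negbTE/eqP; lia.
have n3 : (j + 1 == j) = false by apply/negbTE/eqP; lia.
have n4 : (j - 1 == j) = false by apply/negbTE/eqP; lia.
have n5 : (i + 1 == i - 1) = false by apply/negbTE/eqP; lia.
have n6 : (j + 1 == j - 1) = false by apply/negbTE/eqP; lia.
rewrite /line_nbr !big_cons big_nil !E ?xpair_eqE ?n1 ?n2 ?n3 ?n4 ?andbF//.
rewrite !line_jump_rate ?xpair_eqE ?n1 ?n2 ?n3 ?n4 ?andbF//=.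
rewrite [i - 1 == i + 1]eq_sym [j - 1 == j + 1]eq_sym !eqxx n5 n6 /=.
rewrite !line_exit_rate /line_generator /=; field.
by rewrite gt_eqF// addr_gt0.
Qed.

Context (d : measure_display) (T : measurableType d) (Q : probability T R).
Context (X : R -> T -> int * int).
Hypothesis ctmcX : is_ctmc L Q (0, 0) X.

(** The path is constant between jumps, so the supremum exceeds [eta] exactly when the rescaled
    value at some state [Y n] reached by time [s * t] does. Such a state is outside [B], and
    [exit_prob_le] applies. *)
Lemma line_sup_prob_le (f : int * int -> int) (B : set (int * int))
    (g : int * int -> R) (lambda a eta s t : R) :
  f (0, 0) = 0 -> 0 < eta -> 0 < s -> 0 < t -> 0 < lambda ->
  B (0, 0) -> (forall x, 0 <= g x) -> (forall x, ~ B x -> 1 <= g x) ->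
  (forall x, B x -> L g x <= lambda * g x) ->
  (forall x, eta < s `^ (- (a / 2)) * `|(f x)%:~R| -> ~ B x) ->
  (Q [set w | (eta%:E <
     `| sup_abs (rescaled a (fun u w' => f (X u w')) s) t w |)%E]
   <= (expR (lambda * (s * t)) * g (0, 0))%R%:E)%E.
Proof.
move=> f0 eta0 s0 t0 l0 B0 g0 g1 Lg fB.
have [Y [tau [mY mtau tau0 law XY]]] := ctmcX.
have S0 n w : 0 <= jump_time tau n w.
  by apply: sumr_ge0 => k _; exact: ltW.
have eventE : [set w | (eta%:E <
     `| sup_abs (rescaled a (fun u w' => f (X u w')) s) t w |)%E] =
   \bigcup_n ([set w | eta < s `^ (- (a / 2)) * `|(f (Y n w))%:~R|]
      `&` [set w | jump_time tau n w <= s * t]).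
  have pw : 0 <= s `^ (- (a / 2)) by exact: powR_ge0.
  apply/seteqP; split=> w /=.
    rewrite gee0_abs; last first.
      apply: (@le_trans _ _ `|rescaled a (fun u w' => f (X u w')) s 0 w|%:E) => //.
      apply: ereal_sup_ubound; exists 0 => //=.
      by rewrite in_itv/= lexx ltW.
    move=> /ereal_sup_gt[_ [u /= + <-]]; rewrite in_itv/= => /andP[u0 ut].
    rewrite lte_fin /rescaled normrM ger0_norm// => ux.
    have su0 : 0 <= s * u by rewrite mulr_ge0// ltW.
    have [XS Xexpl] := XY (s * u) w su0.
    (* After an explosion the path sits at the origin, where [f] vanishes, so such a time cannot
       exceed [eta]. *)
    have [expl|] := pselect (forall n, jump_time tau n w <= s * u).
      by move: ux; rewrite Xexpl// f0 normr0 mulr0 ltNge (ltW eta0).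
    move=> /existsNP[n /negP]; rewrite -ltNge => nS.
    have ex : exists n, s * u < jump_time tau n w by exists n.
    (* The least index whose jump time exceeds [s * u] is not 0, since the jump time of index 0 is
       0; its predecessor [m] is the index of the current state. *)
    case: (ex_minnP ex) => -[|m] sm minm.
      by move: sm; rewrite /jump_time big_ord0 ltNge su0.
    have mu : jump_time tau m w <= s * u.
      by rewrite leNgt; apply/negP => /minm; rewrite ltnn.
    exists m => //; split => /=; last first.
      by rewrite (le_trans mu)// ler_wpM2l// ltW.
    by rewrite -(XS m)// mu.
  move=> [n _ [/= fY Sn]].
  have u0 : 0 <= jump_time tau n w / s by rewrite divr_ge0// ltW.
  apply: (@lt_le_trans _ _ `|rescaled a (fun u w' => f (X u w')) s
    (jump_time tau n w / s) w|%:E).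
    rewrite lte_fin /rescaled normrM ger0_norm// mulrCA divff ?gt_eqF// mulr1.
    have [XS _] := XY _ w (S0 n w).
    rewrite (XS n)// lexx /= /jump_time big_ord_recr /= ltrDl; exact: tau0.
  apply: le_trans (lee_abs _); apply: ereal_sup_ubound.
  exists (jump_time tau n w / s) => //=.
  by rewrite in_itv/= u0 /= ler_pdivrMr// mulrC.
rewrite eventE.
have mE n (A : set (int * int)) : measurable
   ([set w | A (Y n w)] `&` [set w | jump_time tau n w <= s * t]).
  apply: measurableI; first exact: (@measurable_state (int * int)%type d T Y mY n A).
  exact: (@measurable_jump_time_le R d T tau mtau n (s * t)).
apply: le_trans (@exit_prob_le R _ L d T Q (0, 0) Y tau lambda l0
  line_exit_rate_gt0 mY mtau tau0 law B g line_nbr B0 g0 g1 line_jump_prob_ge0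
  line_jump_prob_nbr _ (s * t)).
  apply: le_measure; rewrite ?inE.
  - apply: bigcupT_measurable => n.
    exact: (mE n [set x | eta < s `^ (- (a / 2)) * `|(f x)%:~R|]).
  - rewrite (_ : [set _ | _] = \bigcup_n ([set w | (~` B) (Y n w)] `&`
       [set w | jump_time tau n w <= s * t])).
      by apply: bigcupT_measurable => n; exact: mE.
    by apply/seteqP; split=> w /= [n]; [exists n|move=> _ [? ?]; exists n].
  - by move=> w [n _ [/= /fB nB Sn]]; exists n.
move=> x Bx; rewrite sum_line_jump_prob ler_pdivrMr ?line_exit_rate_gt0//.
rewrite mulrAC divfK ?gt_eqF ?line_exit_rate_gt0//.
by rewrite mulrDl addrC lerD2l Lg.
Qed.

End LineChain.

(** * A supersolution for the generator *)

Section Potential.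
Context (R : realType) (h v : int -> R) (K lambda : R).
Local Notation L := (line_generator h v).

(** Uniformization: once [K] dominates all exit rates, [K + L] has nonnegative coefficients, of
    total mass [K]. *)
Definition uniformized (f : int * int -> R) (x : int * int) : R :=
  K * f x + L f x.

(* Partial sum of the Neumann series of [(lambda - L)^-1] obtained from
   [lambda - L = (lambda + K) - (K + L)]: a polynomial in finitely many
   conductances, so that no limit is needed to integrate it. *)
Definition potential n (f : int * int -> R) (x : int * int) : R :=
  \sum_(k < n) iter k uniformized f x / (lambda + K) ^+ k.+1.

Lemma potentialS n f x : potential n.+1 f x =
  potential n f x + iter n uniformized f x / (lambda + K) ^+ n.+1.
Proof. by rewrite /potential big_ord_recr. Qed.

Lemma uniformizedE f x : uniformized f x =
  h x.2 * (f (x.1 + 1, x.2) + f (x.1 - 1, x.2)) +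
  v x.1 * (f (x.1, x.2 + 1) + f (x.1, x.2 - 1)) +
  (K - 2 * (h x.2 + v x.1)) * f x.
Proof. by rewrite /uniformized /line_generator; ring. Qed.

Hypotheses (h_ge0 : forall k, 0 <= h k) (v_ge0 : forall k, 0 <= v k)
  (K_ge : forall i j, 2 * (h i + v j) <= K).

Lemma iter_uniformized_bound n f C : (forall x, 0 <= f x <= C) ->
  forall x, 0 <= iter n uniformized f x <= K ^+ n * C.
Proof.
move=> fC; elim: n => [|n IH] x; first by rewrite expr0 mul1r.
rewrite iterS uniformizedE; set u := iter n _ _ in IH *.
have K0 : 0 <= K - 2 * (h x.2 + v x.1) by rewrite subr_ge0.
have [u0 uC] := (fun y => proj1 (andP (IH y)), fun y => proj2 (andP (IH y))).
apply/andP; split.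
  by rewrite !addr_ge0// mulr_ge0// addr_ge0.
apply: (@le_trans _ _ (h x.2 * (K ^+ n * C + K ^+ n * C) +
  v x.1 * (K ^+ n * C + K ^+ n * C) + (K - 2 * (h x.2 + v x.1)) * (K ^+ n * C))).
  by rewrite lerD// ?lerD// ler_wpM2l// lerD.
by rewrite exprS le_eqVlt; apply/orP; left; apply/eqP; ring.
Qed.

Hypotheses (lambda_gt0 : 0 < lambda).

Let lK_gt0 : 0 < lambda + K.
Proof.
rewrite ltr_wpDr//; apply: le_trans (K_ge 0 0).
by rewrite mulr_ge0// addr_ge0.
Qed.

Lemma potential_ge0 n f x : (forall x, 0 <= f x) -> 0 <= potential n f x.
Proof.
move=> f0; apply: sumr_ge0 => k _; rewrite divr_ge0 ?exprn_ge0 ?(ltW lK_gt0)//.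
elim: (val k) x => {k} [|k IH] x //; rewrite iterS uniformizedE.
have K0 : 0 <= K - 2 * (h x.2 + v x.1) by rewrite subr_ge0.
by rewrite !addr_ge0// mulr_ge0// addr_ge0.
Qed.

(** The sum telescopes because [lambda - L] is [lambda + K] minus the uniformized operator; the last
    term is the truncation error of the Neumann series. *)
Lemma potential_resolvent n f x :
  lambda * potential n f x - L (potential n f) x =
  f x - iter n uniformized f x / (lambda + K) ^+ n.
Proof.
elim: n => [|n IH].
  rewrite /potential big_ord0 expr0 divr1 subrr /line_generator !big_ord0.
  by rewrite !(mulr0, addr0, subr0).
rewrite potentialS (_ : L (potential n.+1 f) x =
   L (potential n f) x + L (iter n uniformized f) x / (lambda + K) ^+ n.+1).
  rewrite (_ : iter n.+1 uniformized f x =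
    K * iter n uniformized f x + L (iter n uniformized f) x)//.
  have := IH; rewrite exprS => /eqP; rewrite subr_eq => /eqP IH'.
  rewrite mulrDr IH'.
  by field; rewrite !gt_eqF// exprn_gt0.
by rewrite /line_generator !potentialS; ring.
Qed.

End Potential.
Arguments uniformized {R}.
Arguments potential {R}.

(** * Truncation of the conductances *)

Section Clip.
Context (R : realType).

(** The inner maximum with 0 keeps truncated conductances nonnegative on every environment, while
    positivity is only known almost surely. *)
Definition clip (M x : R) : R := Num.min (Num.max x 0) M.

Lemma clip_ge0 M x : 0 <= M -> 0 <= clip M x.
Proof. by move=> M0; rewrite /clip le_min M0 andbT le_max lexx orbT. Qed.

Lemma clip_le M x : clip M x <= M.
Proof. by rewrite /clip ge_min lexx orbT. Qed.

Lemma clip_id M x : 0 <= x <= M -> clip M x = x.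
Proof.
by move=> /andP[x0 xM]; rewrite /clip max_l// min_l.
Qed.

(** For [0 < x], the minimum of [x] and [M] is the product of its own powers [1 - beta] and [beta],
    bounded by those of [M] and of [x] respectively. *)
Lemma clip_le_powR M x beta : 0 < M -> 0 < beta <= 1 ->
  clip M x <= M `^ (1 - beta) * x `^ beta.
Proof.
move=> M0 /andP[b0 b1]; have [x0|x0] := leP x 0.
  by rewrite /clip max_r// min_l ?(ltW M0)// mulr_ge0// powR_ge0.
rewrite /clip max_l ?(ltW x0)//; have [xM|Mx] := leP x M.
  rewrite -{1}(powRr1 (ltW x0)) -[X in x `^ X](subrK beta) powRD; last first.
    by rewrite (gt_eqF x0) implybT.
  rewrite ler_wpM2r ?powR_ge0// ge0_ler_powR ?nnegrE ?subr_ge0// ltW//.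
rewrite -{1}(powRr1 (ltW M0)) -[X in M `^ X <= _](subrK beta) powRD; last first.
  by rewrite (gt_eqF M0) implybT.
rewrite ler_wpM2l ?powR_ge0// ge0_ler_powR ?nnegrE ?(ltW b0) ?(ltW M0) ?(ltW Mx)//.
by rewrite (le_trans (ltW M0))// ltW.
Qed.

Lemma measurable_clip M : measurable_fun setT (clip M).
Proof. by apply: measurable_minr => //; exact: measurable_maxr. Qed.

End Clip.
Arguments clip {R}.

(** * The barrier function *)

Section Supersolution.
Context (R : realType) (H V : int -> R) (M1 M2 K lambda A1 A2 delta : R) (n : nat).
Hypotheses (M1_ge0 : 0 <= M1) (M2_ge0 : 0 <= M2) (KE : K = 2 * (M1 + M2))
  (lambda_gt0 : 0 < lambda) (A1_ge0 : 0 <= A1) (A2_ge0 : 0 <= A2).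

(** The image of [A1 * x.1 ^ 2 + A2 * x.2 ^ 2] under the truncated generator, the second difference
    of a square being 2. *)
Definition speed (x : int * int) : R :=
  2 * (A1 * clip M1 (H x.2) + A2 * clip M2 (V x.1)).

Definition barrier_potential : int * int -> R :=
  potential (clip M1 \o H) (clip M2 \o V) K lambda n speed.

(* The constant [delta] absorbs the remainder of the truncated Neumann series. *)
Definition barrier (x : int * int) : R :=
  A1 * x.1%:~R ^+ 2 + A2 * x.2%:~R ^+ 2 + (barrier_potential x + delta).

Lemma speed_ge0 x : 0 <= speed x.
Proof. by rewrite mulr_ge0// addr_ge0// mulr_ge0// clip_ge0. Qed.

Let K_ge i j : 2 * ((clip M1 \o H) i + (clip M2 \o V) j) <= K.
Proof. by rewrite KE ler_wpM2l// lerD// clip_le. Qed.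

Lemma barrier_potential_ge0 x : 0 <= barrier_potential x.
Proof.
apply: potential_ge0 => // [k|k|y]; [exact: clip_ge0|exact: clip_ge0|].
exact: speed_ge0.
Qed.

Hypothesis delta_ge :
  2 * (A1 * M1 + A2 * M2) * (K / (lambda + K)) ^+ n <= lambda * delta.

Lemma delta_ge0 : 0 <= delta.
Proof.
have K0 : 0 <= K by rewrite KE mulr_ge0// addr_ge0.
rewrite -(pmulr_rge0 _ lambda_gt0); apply: le_trans delta_ge.
rewrite mulr_ge0 ?exprn_ge0 ?divr_ge0 ?addr_ge0 ?(ltW lambda_gt0)//.
by rewrite mulr_ge0// addr_ge0// mulr_ge0.
Qed.

Lemma barrier_ge0 x : 0 <= barrier x.
Proof.
rewrite addr_ge0 ?addr_ge0 ?barrier_potential_ge0 ?delta_ge0//;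
  by rewrite mulr_ge0// exprn_even_ge0.
Qed.

(** The generator maps the quadratic part to [speed x], which the resolvent identity for the
    potential cancels up to the Neumann remainder; [lambda * delta] dominates that remainder. What
    is left over, [lambda] times the quadratic part, is nonnegative. *)
Lemma barrier_super x : 0 <= H x.2 <= M1 -> 0 <= V x.1 <= M2 ->
  line_generator H V barrier x <= lambda * barrier x.
Proof.
move=> Hx Vx.
have K0 : 0 <= K by rewrite KE mulr_ge0// addr_ge0.
have lK : 0 < lambda + K by rewrite ltr_wpDr.
have hge k : 0 <= (clip M1 \o H) k by exact: clip_ge0.
have vge k : 0 <= (clip M2 \o V) k by exact: clip_ge0.
have res := @potential_resolvent R (clip M1 \o H) (clip M2 \o V) K lambda
  hge vge K_ge lambda_gt0 n speed x.
(* The generator at [x] reads only [H x.2] and [V x.1], both below their levels, so clipping is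
   invisible at [x] however large the other conductances are. *)
have LE : line_generator (clip M1 \o H) (clip M2 \o V) barrier_potential x =
  line_generator H V barrier_potential x.
  by rewrite /line_generator /= !clip_id.
rewrite -/barrier_potential LE in res.
have rem : iter n (uniformized (clip M1 \o H) (clip M2 \o V) K) speed x
    / (lambda + K) ^+ n <= lambda * delta.
  apply: le_trans delta_ge.
  have speed_bound y : 0 <= speed y <= 2 * (A1 * M1 + A2 * M2).
    by rewrite speed_ge0 /= ler_wpM2l// lerD// ler_wpM2l// clip_le.
  have /andP[_] := @iter_uniformized_bound R _ _ K hge vge K_ge n speed _ speed_bound x.
  move=> it; rewrite expr_div_n ler_pdivrMr ?exprn_gt0// mulrA divfK.
    by rewrite mulrC.
  by rewrite gt_eqF// exprn_gt0.
have gE : line_generator H V barrier x =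
    speed x + line_generator H V barrier_potential x.
  rewrite /speed !clip_id// /line_generator /barrier /= !rmorphD /= !rmorphN /=.
  by ring.
have sq : 0 <= lambda * (A1 * x.1%:~R ^+ 2 + A2 * x.2%:~R ^+ 2).
  by rewrite mulr_ge0 ?(ltW lambda_gt0)// addr_ge0// mulr_ge0// exprn_even_ge0.
rewrite gE /barrier !mulrDr -mulrDr.
by move: res rem sq; set p := lambda * barrier_potential x; lra.
Qed.

End Supersolution.
Arguments speed {R}.
Arguments barrier_potential {R}.
Arguments barrier {R}.

(** * Stationarity of the environment *)

Section EnvironmentSpace.
Context (R : realType).
Local Notation env := ((int -> R) * (int -> R))%type.

(** Finite-dimensional rectangles: a pi-system generating the product sigma-algebra on pairs of
    conductance families, on which laws of environments are compared. *)
Definition env_rectangle : set (set env) :=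
  [set A | exists (s : seq int) (B C : int -> set R),
    [/\ uniq s, (forall i, measurable (B i)), (forall i, measurable (C i))
      & A = [set e | forall i, i \in s -> B i (e.1 i) /\ C i (e.2 i)]]].

Local Notation Env := (g_sigma_algebraType env_rectangle).

Lemma env_rectangle_setI : setI_closed env_rectangle.
Proof.
move=> _ _ [s [B [C [us mB mC ->]]]] [s' [B' [C' [us' mB' mC' ->]]]].
pose cut (r : seq int) (D : int -> set R) i := if i \in r then D i else setT.
have mcut r D : (forall i, measurable (D i)) -> forall i, measurable (cut r D i).
  by move=> mD i; rewrite /cut; case: ifP.
exists (undup (s ++ s')), (fun i => cut s B i `&` cut s' B' i),
  (fun i => cut s C i `&` cut s' C' i); split.
- exact: undup_uniq.
- by move=> i; apply: measurableI; exact: mcut.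
- by move=> i; apply: measurableI; exact: mcut.
apply/seteqP; split=> e /=.
  move=> [h h'] i _; rewrite /cut; case: ifPn => [/h[]|_];
    by case: ifPn => [/h'[]|_].
move=> h; split=> i si; have := h i; rewrite mem_undup mem_cat si ?orbT /cut si.
  by move=> /(_ isT)[[] ? _ [] ? _].
by move=> /(_ isT)[[] _ ? [] _ ?].
Qed.

Lemma measurable_env1 i : measurable_fun setT (fun e : Env => e.1 i).
Proof.
move=> _ B mB; rewrite setTI; apply: sub_sigma_algebra.
exists [:: i], (fun=> B), (fun=> setT); split=> //.
apply/seteqP; split=> e /=; first by move=> Bi j; rewrite inE => /eqP ->.
by move=> /(_ i); rewrite inE eqxx => /(_ isT)[].
Qed.

Lemma measurable_env2 i : measurable_fun setT (fun e : Env => e.2 i).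
Proof.
move=> _ B mB; rewrite setTI; apply: sub_sigma_algebra.
exists [:: i], (fun=> setT), (fun=> B); split=> //.
apply/seteqP; split=> e /=; first by move=> Bi j; rewrite inE => /eqP ->.
by move=> /(_ i); rewrite inE eqxx => /(_ isT)[].
Qed.

Context (d : measure_display) (T : measurableType d) (P : probability T R).
Context (H V : int -> {RV P >-> R}).

(** The environment seen from the site [(a, b)]: [H] is indexed by the second coordinate and [V] by
    the first, hence the crossed shifts. *)
Definition env_of (a b : int) (w : T) : Env :=
  (fun i => H (i + b) w, fun i => V (i + a) w).

Lemma measurable_env_of a b : measurable_fun setT (env_of a b).
Proof.
apply: (@measurability _ _ T Env setT (env_of a b) env_rectangle) => //.
move=> _ [_ [s [B [C [us mB mC ->]]]] <-].
rewrite setTI (_ : _ @^-1` _ = \bigcap_(i in [set` s])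
   (H (i + b) @^-1` B i `&` V (i + a) @^-1` C i)).
  rewrite bigcap_seq; apply: bigsetI_measurable => i _.
  by apply: measurableI; rewrite -[X in measurable X]setTI; exact: measurable_funPT.
by apply/seteqP; split.
Qed.

Hypotheses (iidH : iid H) (iidV : iid V) (indepHV : independent_families H V).

Lemma iid_shift_prob (Z : int -> {RV P >-> R}) (s : seq int) (B : int -> set R) b :
  iid Z -> uniq s -> (forall i, measurable (B i)) ->
  P (\bigcap_(i in [set` s]) (Z (i + b) @^-1` B i)) =
  (\prod_(i <- s) P (Z 0%R @^-1` B i))%E.
Proof.
move=> [indZ idZ] us mB.
pose B' i := B (i - b).
have mB' i : measurable (B' i) by exact: mB.
have us' : uniq [seq i + b | i <- s] by rewrite map_inj_uniq//; exact: addIr.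
transitivity (P (\bigcap_(i in [set` [seq i + b | i <- s]]) (Z i @^-1` B' i))).
  congr (P _); apply/seteqP; split => w /= h i.
    by move=> /mapP[j js ->] /=; rewrite /B' addrK; exact: h.
  move=> /= js; have := h (i + b); rewrite /B' /= addrK; apply.
  by apply/mapP; exists i.
rewrite indZ// big_map; apply: eq_bigr => i _.
by rewrite /B' addrK; exact: (idZ (i + b) 0 (B i) (mB i)).
Qed.

Lemma sigma_of_family_bigcap (Z : int -> {RV P >-> R}) (s : seq int) (B : int -> set R) b :
  (forall i, measurable (B i)) ->
  sigma_of_family Z (\bigcap_(i in [set` s]) (Z (i + b) @^-1` B i)).
Proof.
move=> mB; pose G := [set A | exists i, exists2 B : set R, measurable B & A = Z i @^-1` B].
rewrite bigcap_seq.
apply: (@bigsetI_measurable _ (g_sigma_algebraType G)) => i _.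
by apply: sub_sigma_algebra; exists (i + b), (B i).
Qed.

(** Stationarity: both environments give each rectangle the same product of one-site probabilities,
    and a pi-system determines the law. *)
Lemma env_of_shift a b (F : Env -> \bar R) :
  measurable_fun setT F -> (forall e, 0 <= F e)%E ->
  (\int[P]_w F (env_of a b w) = \int[P]_w F (env_of 0%R 0%R w))%E.
Proof.
move=> mF F0.
pose phi a b : {mfun T >-> Env} :=
  HB.pack (env_of a b) (isMeasurableFun.Build _ _ _ _ _ (measurable_env_of a b)).
have Eab a' b' : (\int[P]_w F (env_of a' b' w) = \int[distribution P (phi a' b')]_e F e)%E.
  by rewrite ge0_integral_distribution.
rewrite !Eab; apply: eq_measure_integral => A mA _.
apply: (@measure_unique _ R Env env_rectangle (fun=> setT) _ _ _ _
  (distribution P (phi a b)) (distribution P (phi 0 0))) => //.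
- exact: env_rectangle_setI.
- by move=> _; exists [::], (fun=> setT), (fun=> setT); split=> //; apply/seteqP.
- by rewrite bigcup_const.
- move=> _ [s [B [C [us mB mC ->]]]].
  have law a' b' : distribution P (phi a' b')
      [set e | forall i, i \in s -> B i (e.1 i) /\ C i (e.2 i)] =
      ((\prod_(i <- s) P (H 0%R @^-1` B i)) * (\prod_(i <- s) P (V 0%R @^-1` C i)))%E.
    rewrite -(iid_shift_prob H s B b' iidH us mB) -(iid_shift_prob V s C a' iidV us mC).
    rewrite -indepHV; [|exact: sigma_of_family_bigcap..].
    congr (P _); apply/seteqP; split => w /=.
      by move=> h; split=> i /= /h[].
    by move=> [h h'] i si; split; [exact: h|exact: h'].
  exact: etrans (law a b) (esym (law 0 0)).
- by move=> _; rewrite (le_lt_trans (probability_le1 _ _))// ltry.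
Qed.

Context (M1 M2 K lambda A1 A2 : R) (n : nat).
Hypotheses (M1_ge0 : 0 <= M1) (M2_ge0 : 0 <= M2) (KE : K = 2 * (M1 + M2))
  (lambda_gt0 : 0 < lambda) (A1_ge0 : 0 <= A1) (A2_ge0 : 0 <= A2).

Let term k x (e : Env) : R :=
  iter k (uniformized (clip M1 \o e.1) (clip M2 \o e.2) K)
    (speed e.1 e.2 M1 M2 A1 A2) x.

Lemma termS k x e : term k.+1 x e =
  clip M1 (e.1 x.2) * (term k (x.1 + 1, x.2) e + term k (x.1 - 1, x.2) e) +
  clip M2 (e.2 x.1) * (term k (x.1, x.2 + 1) e + term k (x.1, x.2 - 1) e) +
  (K - 2 * (clip M1 (e.1 x.2) + clip M2 (e.2 x.1))) * term k x e.
Proof. by rewrite /term iterS uniformizedE. Qed.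

Let measurable_clip1 i : measurable_fun setT (fun e : Env => clip M1 (e.1 i)).
Proof. exact: (measurableT_comp (measurable_clip _ _) (measurable_env1 i)). Qed.

Let measurable_clip2 i : measurable_fun setT (fun e : Env => clip M2 (e.2 i)).
Proof. exact: (measurableT_comp (measurable_clip _ _) (measurable_env2 i)). Qed.

Lemma measurable_term k x : measurable_fun setT (term k x).
Proof.
elim: k x => [|k IH] x.
  by apply: measurable_funM => //; apply: measurable_funD; exact: measurable_funM.
rewrite (funext (termS k x)).
apply: measurable_funD; last first.
  apply: measurable_funM => //; apply: measurable_funB => //.
  by apply: measurable_funM => //; exact: measurable_funD.
by apply: measurable_funD; apply: measurable_funM => //; exact: measurable_funD.
Qed.

(** Translation covariance, through which stationarity of the environment reaches the values of
    [term] at neighbouring sites. *)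
Lemma term_shift k x a b e :
  term k (x.1 + a, x.2 + b) e =
  term k x (fun i => e.1 (i + b), fun i => e.2 (i + a)).
Proof.
elim: k x => [//|k IH] x; rewrite !termS /= -!IH /=.
by rewrite !(addrAC _ a) !(addrAC _ b).
Qed.

Let C := 2 * (A1 * M1 + A2 * M2).

Lemma term_bound k x e : 0 <= term k x e <= K ^+ k * C.
Proof.
apply: iter_uniformized_bound => [i|i|i j|y]; rewrite /= ?clip_ge0//.
  by rewrite KE ler_wpM2l// lerD// clip_le.
by rewrite speed_ge0//= ler_wpM2l// lerD// ler_wpM2l// clip_le.
Qed.

Let integrable_bounded (F : Env -> R) a b D : measurable_fun setT F ->
  (forall e, 0 <= F e <= D) -> P.-integrable setT (EFin \o (F \o env_of a b)).
Proof.
move=> mF FD; apply: measurable_bounded_integrable => //.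
- by rewrite (le_lt_trans (probability_le1 _ _))// ltry.
- exact: (measurableT_comp mF (measurable_env_of a b)).
exists D; split; first exact: num_real.
move=> M DM w _ /=; have /andP[F0 FD'] := FD (env_of a b w).
by rewrite ger0_norm// (le_trans FD')// ltW.
Qed.

(* [c] is invariant under the shift applied to the potential, so the product is
   itself a shifted function of the environment. *)
Lemma Rintegral_term_shift (c : Env -> R) k a b D : measurable_fun setT c ->
  (forall e, 0 <= c e <= D) ->
  (forall e, c (fun i => e.1 (i + b), fun i => e.2 (i + a)) = c e) ->
  \int[P]_w (c (env_of 0 0 w) * term k (a, b) (env_of 0 0 w)) =
  \int[P]_w (c (env_of 0 0 w) * term k (0, 0) (env_of 0 0 w)).
Proof.
move=> mc cD cs; have c0 e : 0 <= c e by have /andP[] := cD e.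
pose F e := c e * term k (0, 0) e.
have F0 e : 0 <= F e by rewrite mulr_ge0//; have /andP[] := term_bound k (0, 0) e.
have mF : measurable_fun setT (EFin \o F).
  by apply/measurable_EFinP/measurable_funM => //; exact: measurable_term.
have := @env_of_shift a b (EFin \o F) mF F0.
rewrite /Rintegral => <-; congr fine; apply: eq_integral => w _ /=.
congr EFin; rewrite /F.
have -> : env_of a b w =
   (fun i => (env_of 0 0 w).1 (i + b), fun i => (env_of 0 0 w).2 (i + a)).
  by rewrite /env_of /=; congr pair; apply/funext => i; rewrite addr0.
by rewrite cs -term_shift !add0r.
Qed.

(** Apart from the factor [K] there remain increments of [term k], weighted by the truncated [H 0]
    horizontally and by the truncated [V 0] vertically. Each weight is invariant under shifts in its
    own direction, so these increments have mean zero. *)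
Lemma Rintegral_termS k :
  \int[P]_w term k.+1 (0, 0) (env_of 0 0 w) =
  K * \int[P]_w term k (0, 0) (env_of 0 0 w).
Proof.
pose c1 (e : Env) := clip M1 (e.1 0); pose c2 (e : Env) := clip M2 (e.2 0).
have c1D e : 0 <= c1 e <= M1 by rewrite clip_ge0// clip_le.
have c2D e : 0 <= c2 e <= M2 by rewrite clip_ge0// clip_le.
pose I c x := \int[P]_w (c (env_of 0 0 w) * term k x (env_of 0 0 w)).
have int (c : Env -> R) (D : R) (x : int * int) :
    measurable_fun setT c -> (forall e, 0 <= c e <= D) ->
    P.-integrable setT (EFin \o (fun w => c (env_of 0 0 w) * term k x (env_of 0 0 w))).
  move=> mc cD; apply: (@integrable_bounded (fun e => c e * term k x e) 0 0 (D * (K ^+ k * C))).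
    by apply: measurable_funM => //; exact: measurable_term.
  move=> e; have /andP[c0 cD'] := cD e; have /andP[t0 tD] := term_bound k x e.
  by rewrite mulr_ge0//= ler_pM.
have m1 : measurable_fun setT c1 by exact: measurable_clip1.
have m2 : measurable_fun setT c2 by exact: measurable_clip2.
have i1 x := int c1 M1 x m1 c1D; have i2 x := int c2 M2 x m2 c2D.
have iK : P.-integrable setT (EFin \o (fun w => term k (0, 0) (env_of 0 0 w))).
  exact: (@integrable_bounded (term k (0, 0)) 0 0 _ (measurable_term k (0, 0))
    (term_bound k (0, 0))).
have s1 a : I c1 (a, 0) = I c1 (0, 0).
  by apply: (@Rintegral_term_shift c1 k a 0 M1 m1 c1D) => e; rewrite /c1 /= addr0.
have s2 b : I c2 (0, b) = I c2 (0, 0).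
  by apply: (@Rintegral_term_shift c2 k 0 b M2 m2 c2D) => e; rewrite /c2 /= addr0.
pose D1 a w := c1 (env_of 0 0 w) * term k (a, 0) (env_of 0 0 w) -
  c1 (env_of 0 0 w) * term k (0, 0) (env_of 0 0 w).
pose D2 b w := c2 (env_of 0 0 w) * term k (0, b) (env_of 0 0 w) -
  c2 (env_of 0 0 w) * term k (0, 0) (env_of 0 0 w).
have iD1 a : P.-integrable setT (EFin \o D1 a).
  exact: (integrableB measurableT (i1 (a, 0)) (i1 (0, 0))).
have iD2 b : P.-integrable setT (EFin \o D2 b).
  exact: (integrableB measurableT (i2 (0, b)) (i2 (0, 0))).
have D10 a : \int[P]_w D1 a w = 0.
  by rewrite /D1 RintegralB// -/(I c1 (a, 0)) -/(I c1 (0, 0)) s1 subrr.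
have D20 b : \int[P]_w D2 b w = 0.
  by rewrite /D2 RintegralB// -/(I c2 (0, b)) -/(I c2 (0, 0)) s2 subrr.
pose S1 w := D1 1 w + D1 (-1) w; pose S2 w := D2 1 w + D2 (-1) w.
have iS1 : P.-integrable setT (EFin \o S1).
  exact: (integrableD measurableT (iD1 1) (iD1 (-1))).
have iS2 : P.-integrable setT (EFin \o S2).
  exact: (integrableD measurableT (iD2 1) (iD2 (-1))).
have iS12 : P.-integrable setT (EFin \o (fun w => S1 w + S2 w)).
  exact: (integrableD measurableT iS1 iS2).
have iKt : P.-integrable setT (EFin \o (fun w => K * term k (0, 0) (env_of 0 0 w))).
  exact: (integrableZl measurableT K iK).
have -> : \int[P]_w term k.+1 (0, 0) (env_of 0 0 w) =
    \int[P]_w (K * term k (0, 0) (env_of 0 0 w) + (S1 w + S2 w)).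
  apply: eq_Rintegral => w _; rewrite termS /= !add0r /S1 /S2 /D1 /D2 /c1 /c2 /=.
  by ring.
rewrite RintegralD// RintegralZl// RintegralD// RintegralD// !D10.
by rewrite RintegralD// !D20 !addr0.
Qed.

Lemma Rintegral_term k :
  \int[P]_w term k (0, 0) (env_of 0 0 w) =
  K ^+ k * \int[P]_w term 0 (0, 0) (env_of 0 0 w).
Proof.
elim: k => [|k IH]; first by rewrite expr0 mul1r.
by rewrite Rintegral_termS IH exprS mulrA.
Qed.

Lemma measurable_barrier_potential :
  measurable_fun setT (fun w => barrier_potential (fun k => H k w) (fun k => V k w)
    M1 M2 K lambda A1 A2 n (0, 0)).
Proof.
rewrite (_ : (fun w => _) = (fun w => \sum_(k < n)
    term k (0, 0) (env_of 0 0 w) / (lambda + K) ^+ k.+1)).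
  apply: measurable_sum => k; apply: measurable_funM => //.
  exact: (measurableT_comp (measurable_term k (0, 0)) (measurable_env_of 0 0)).
apply/funext => w; rewrite /term.
have -> : env_of 0 0 w = (fun i => H i w, fun i => V i w).
  by rewrite /env_of; congr pair; apply/funext => i; rewrite addr0.
by [].
Qed.

(** Each Neumann term has mean [K ^+ k / (lambda + K) ^+ k.+1] times the mean speed at the origin,
    and these factors sum to at most [lambda^-1], uniformly in [n] and [K]. *)
Lemma barrier_potential_expectation (m1 m2 : R) :
  (\int[P]_w (clip M1 (H 0%R w))%:E <= m1%:E)%E ->
  (\int[P]_w (clip M2 (V 0%R w))%:E <= m2%:E)%E ->
  (\int[P]_w (barrier_potential (fun k => H k w) (fun k => V k w)
       M1 M2 K lambda A1 A2 n (0%R, 0%R))%:E <=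
   (2 / lambda * (A1 * m1 + A2 * m2))%R%:E)%E.
Proof.
move=> Hm Vm.
have K0 : 0 <= K by rewrite KE mulr_ge0// addr_ge0.
have lK : 0 < lambda + K by rewrite ltr_wpDr.
have envE w : env_of 0 0 w = (fun i => H i w, fun i => V i w).
  by rewrite /env_of; congr pair; apply/funext => i; rewrite addr0.
have t0 k x e : 0 <= term k x e by have /andP[] := term_bound k x e.
have mt k : measurable_fun setT (fun w => term k (0, 0) (env_of 0 0 w)).
  exact: (measurableT_comp (measurable_term k (0, 0)) (measurable_env_of 0 0)).
have It k : (\int[P]_w (term k (0%R, 0%R) (env_of 0%R 0%R w))%:E =
    (K ^+ k * \int[P]_w term 0 (0, 0) (env_of 0 0 w))%R%:E)%E.
  rewrite -Rintegral_term /Rintegral fineK// integrable_fin_num//.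
  exact: (@integrable_bounded (term k (0, 0)) 0 0 _ (measurable_term k (0, 0))
    (term_bound k (0, 0))).
have I0 : \int[P]_w term 0 (0, 0) (env_of 0 0 w) <= 2 * (A1 * m1 + A2 * m2).
  rewrite -lee_fin; have := It 0%N; rewrite expr0 mul1r => <-.
  have -> : (\int[P]_w (term 0 (0%R, 0%R) (env_of 0%R 0%R w))%:E =
     (2 * A1)%R%:E * \int[P]_w (clip M1 (H 0%R w))%:E +
     (2 * A2)%R%:E * \int[P]_w (clip M2 (V 0%R w))%:E)%E.
    have mc1 : measurable_fun setT (fun w => (clip M1 (H 0%R w))%:E).
      apply/measurable_EFinP; apply: measurableT_comp => //.
      exact: measurable_clip.
    have mc2 : measurable_fun setT (fun w => (clip M2 (V 0%R w))%:E).
      apply/measurable_EFinP; apply: measurableT_comp => //.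
      exact: measurable_clip.
    have p1 w : (0 <= (clip M1 (H 0%R w))%:E)%E by rewrite lee_fin clip_ge0.
    have p2 w : (0 <= (clip M2 (V 0%R w))%:E)%E by rewrite lee_fin clip_ge0.
    rewrite -!ge0_integralZl//; [|by rewrite lee_fin mulr_ge0..].
    rewrite -ge0_integralD//.
    - by apply: eq_integral => w _; rewrite envE /term /speed /= -EFinD; congr EFin; ring.
    - by move=> w _; rewrite mule_ge0// lee_fin mulr_ge0.
    - exact: measurable_funeM.
    - by move=> w _; rewrite mule_ge0// lee_fin mulr_ge0.
    - exact: measurable_funeM.
  rewrite mulrDr !mulrA EFinD; apply: leeD; rewrite [X in (_ <= X)%E]EFinM lee_wpmul2l//;
    by rewrite lee_fin mulr_ge0.
have J0 : 0 <= \int[P]_w term 0 (0, 0) (env_of 0 0 w).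
  by apply: Rintegral_ge0 => w _; exact: t0.
have geom : \sum_(k < n) K ^+ k / (lambda + K) ^+ k.+1 <= lambda^-1.
  rewrite -(ler_pM2l lambda_gt0) divff ?gt_eqF//.
  suff -> : lambda * (\sum_(k < n) K ^+ k / (lambda + K) ^+ k.+1) =
      1 - (K / (lambda + K)) ^+ n.
    by rewrite lerBlDr lerDl exprn_ge0// divr_ge0// ltW.
  elim: n => [|m IH]; first by rewrite big_ord0 mulr0 expr0 subrr.
  rewrite big_ord_recr /= mulrDr IH !expr_div_n !exprS; field.
  by rewrite !gt_eqF// exprn_gt0.
have -> : (\int[P]_w (barrier_potential (fun k => H k w) (fun k => V k w)
       M1 M2 K lambda A1 A2 n (0%R, 0%R))%:E =
  ((\sum_(k < n) K ^+ k / (lambda + K) ^+ k.+1) *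
     \int[P]_w term 0 (0, 0) (env_of 0 0 w))%R%:E)%E.
  have -> : (\int[P]_w (barrier_potential (fun k => H k w) (fun k => V k w)
         M1 M2 K lambda A1 A2 n (0%R, 0%R))%:E =
    \int[P]_w (\sum_(k <- index_enum 'I_n) ((lambda + K) ^- k.+1)%R%:E *
       (term k (0%R, 0%R) (env_of 0%R 0%R w))%:E))%E.
    apply: eq_integral => w _; rewrite envE /barrier_potential /potential -sumEFin.
    by apply: eq_bigr => k _; rewrite -EFinM mulrC.
  have q0 k : 0 <= (lambda + K) ^- k by rewrite invr_ge0 exprn_ge0// ltW.
  rewrite ge0_integral_sum//; last 2 first.
  - by move=> k; apply: measurable_funeM; exact/measurable_EFinP.
  - by move=> k w _; rewrite mule_ge0// lee_fin.
  rewrite mulr_suml -sumEFin; apply: eq_bigr => k _.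
  rewrite ge0_integralZl//; last 3 first.
  - exact/measurable_EFinP.
  - by move=> w _; rewrite lee_fin.
  - by rewrite lee_fin.
  by rewrite It -EFinM; congr EFin; ring.
rewrite lee_fin (le_trans (ler_wpM2r J0 geom))//.
by rewrite [2 / _]mulrC -mulrA ler_wpM2l// invr_ge0 ltW.
Qed.

End EnvironmentSpace.

(** * Moments and exponents *)

Section GeometricBounds.
Context (R : realType).

Lemma sum_expr_le (q : R) n : 0 <= q < 1 -> \sum_(k < n) q ^+ k <= (1 - q)^-1.
Proof.
move=> /andP[q0 q1]; have d0 : 0 < 1 - q by rewrite subr_gt0.
rewrite -(ler_pM2l d0) divff ?gt_eqF//.
have -> : (1 - q) * (\sum_(k < n) q ^+ k) = 1 - q ^+ n.
  by rewrite -[RHS]opprB subrX1 -mulNr opprB.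
by rewrite lerBlDr lerDl exprn_ge0.
Qed.

Lemma nneseries_geometric_lty (u : nat -> \bar R) (a q : R) : 0 <= q < 1 ->
  (forall k, 0 <= u k)%E -> (forall k, (u k <= (a * q ^+ k)%:E)%E) ->
  (\sum_(k <oo) u k < +oo)%E.
Proof.
move=> q01 u0 ua.
have a0 : 0 <= a by have := le_trans (u0 0%N) (ua 0%N); rewrite expr0 mulr1 lee_fin.
apply: (@le_lt_trans _ _ (a * (1 - q)^-1)%:E); last exact: ltry.
apply: lime_le; first by apply: is_cvg_nneseries => k _ _.
apply: nearW => n; rewrite big_mkord.
apply: (@le_trans _ _ (\sum_(k < n) (a * q ^+ k)%:E)%E).
  by apply: lee_sum => k _.
by rewrite sumEFin lee_fin -mulr_sumr ler_wpM2l// sum_expr_le.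
Qed.

Lemma powR2_lt1 (x : R) : x < 0 -> 0 <= 2 `^ x < 1.
Proof.
move=> x0; rewrite powR_ge0 /= -[x]opprK powRN invf_lt1 ?powR_gt0//.
have nx0 : 0 < - x by rewrite oppr_gt0.
have := @gt0_ltr_powR R (- x) nx0 1 2; rewrite powR1; apply => //.
- by rewrite nnegrE.
- by rewrite nnegrE.
- by rewrite ltr1n.
Qed.

Lemma exists_expr_le (q C e : R) : 0 <= q < 1 -> 0 < e -> exists n, C * q ^+ n <= e.
Proof.
move=> /andP[q0 q1] e0.
have : (fun n => C * q ^+ n) @ \oo --> (0 : R).
  rewrite -[X in _ --> X](mulr0 C); apply: cvgMr; apply: cvg_expr.
  by rewrite ger0_norm.
move=> /cvgrPdist_le /(_ _ e0)[N _ /(_ N (leqnn N))]; rewrite sub0r normrN => h.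
by exists N; apply: le_trans h; exact: ler_norm.
Qed.

Context (d : measure_display) (T : measurableType d) (P : probability T R).

(** Borel-Cantelli in integrated form: the series of the [Z k] has finite expectation, hence
    converges almost everywhere, and its terms tend to 0. *)
Lemma ae_cvg0_of_geometric_expectation (Z : nat -> T -> R) (a q : R) : 0 <= q < 1 ->
  (forall k, measurable_fun setT (Z k)) -> (forall k w, 0 <= Z k w) ->
  (forall k, \int[P]_w (Z k w)%:E <= (a * q ^+ k)%:E)%E ->
  \forall w \ae P, Z k w @[k --> \oo] --> (0 : R).
Proof.
move=> q01 mZ Z0 IZ.
have mEZ k : measurable_fun setT (fun w => (Z k w)%:E) by exact/measurable_EFinP.
have Z0' k w : (0 <= (Z k w)%:E)%E by rewrite lee_fin.
have fin : (\int[P]_w (\sum_(k <oo) (Z k w)%:E) < +oo)%E.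
  rewrite integral_nneseries//; apply: nneseries_geometric_lty q01 _ IZ => k.
  exact: integral_ge0.
have int : P.-integrable setT (fun w => \sum_(k <oo) (Z k w)%:E)%E.
  apply/integrableP; split.
    by apply: ge0_emeasurable_sum.
  under eq_integral do rewrite gee0_abs ?nneseries_ge0//.
  exact: fin.
have := integrable_ae measurableT int; apply: filterS => w /(_ I) Zfin.
apply: cvg_series_cvg_0; apply: nondecreasing_is_cvgn.
  by apply/nondecreasing_seqP => n; rewrite /series /= big_nat_recr//= lerDl.
exists (fine (\sum_(k <oo) (Z k w)%:E)) => _ [n _ <-].
rewrite -lee_fin fineK// /series /= -sumEFin.
by apply: nneseries_lim_ge => k _ _.
Qed.

Lemma identically_distributed_integral (I : Type) (Z : I -> {RV P >-> R}) i j
    (F : R -> \bar R) :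
  identically_distributed Z -> measurable_fun setT F -> (forall x, 0 <= F x)%E ->
  (\int[P]_w F (Z i w) = \int[P]_w F (Z j w))%E.
Proof.
move=> idZ mF F0.
rewrite -(ge0_integral_distribution (Z i) mF F0) -(ge0_integral_distribution (Z j) mF F0).
by apply: eq_measure_integral => A mA _; exact: idZ.
Qed.

Lemma measurable_RV_powR (Z : {RV P >-> R}) (beta : R) :
  measurable_fun setT (fun w => Z w `^ beta).
Proof.
by apply: (measurableT_comp (f := (@powR R)^~ beta)); first exact: measurable_powR.
Qed.

(** Dyadic decomposition: for [2 ^+ j < Z w <= 2 ^+ j.+1] the power is at most [(2 ^+ j.+1) ^ beta],
    and the tail at [2 ^+ j] is at most of order [2 ^ (- gamma * j)] for some [gamma] strictly
    between [beta] and [alpha], so the sum is geometric. *)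
Lemma regular_tail_powR_lty (Z : {RV P >-> R}) (C alpha beta : R) :
  0 < beta < alpha -> 0 < C -> regular_tail Z C alpha ->
  (\int[P]_w (Z w `^ beta)%:E < +oo)%E.
Proof.
move=> /andP[b0 ba] C0 [err err0 tailZ].
have a0 : 0 < alpha by exact: lt_trans ba.
pose gamma := (alpha + beta) / 2.
have bg : beta < gamma by rewrite /gamma; lra.
have ga : gamma < alpha by rewrite /gamma; lra.
have g0 : 0 < gamma by exact: lt_trans bg.
have near_tail : \forall L \near +oo,
    (P [set w | (L < Z w)%R] <= (C * L `^ (- gamma))%:E)%E.
  (* If the error is at most [1 - gamma / alpha] in absolute value, the tail exponent
     [alpha * (1 + err L)] is at least [gamma]. *)
  have e0 : 0 < 1 - gamma / alpha by rewrite subr_gt0 ltr_pdivrMr// mul1r.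
  move/cvgrPdist_le : err0 => /(_ _ e0) err0.
  near=> L.
  have -> : P [set w | L < Z w] = (C * L `^ (- (alpha * (1 + err L))))%:E.
    by near: L.
  have L1 : 1 <= L by near: L; apply: nbhs_pinfty_ge; rewrite num_real.
  rewrite lee_fin ler_pM2l//; apply: ler_powR => //.
  have : `|0 - err L| <= 1 - gamma / alpha by near: L.
  rewrite sub0r normrN => /ler_normlP[errL _].
  rewrite lerN2 -ler_pdivrMl// mulrC; lra.
have [N tailN] : exists N : nat, forall j, (N <= j)%N ->
    (P [set w | (2 ^+ j < Z w)%R] <= (C * (2 `^ (- gamma)) ^+ j)%:E)%E.
  have [M [_ hM]] := near_tail.
  exists (Num.bound `|M|) => j Nj.
  have := hM (2 ^+ j); rewrite (_ : (2 ^+ j) `^ (- gamma) = (2 `^ (- gamma)) ^+ j).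
    apply.
    apply: (@lt_le_trans _ _ (Num.bound `|M|)%:R).
      by apply: le_lt_trans (ler_norm M) _; apply: archi_boundP.
    by rewrite -natrX ler_nat (leq_trans Nj)// ltnW// ltn_expl.
  by rewrite -powR_mulrn// -powRrM -powR_mulrn ?powR_ge0// -powRrM mulrC.
pose u k w : \bar R := ((2 `^ beta) ^+ (N + k).+1 * (2 ^+ (N + k) < Z w)%R%:R)%:E.
have u0 k w : (0 <= u k w)%E by rewrite lee_fin mulr_ge0// exprn_ge0// powR_ge0.
have msetZ j : measurable [set w | 2 ^+ j < Z w].
  rewrite (_ : [set w | 2 ^+ j < Z w] = Z @^-1` `]2 ^+ j, +oo[).
    by rewrite -[X in measurable X]setTI; exact: measurable_funPT.
  by apply/seteqP; split=> w /=; rewrite in_itv /= andbT.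
have uE k : u k = fun w =>
    (((2 `^ beta) ^+ (N + k).+1)%:E * (\1_[set w | (2 ^+ (N + k) < Z w)%R] w)%:E)%E.
  apply/funext => w; rewrite /u -EFinM indicE; congr (_ * _)%:E.
  by congr ((nat_of_bool _)%:R); apply/idP/idP; rewrite inE.
have mu k : measurable_fun setT (u k).
  rewrite uE; apply: measurable_funeM; apply/measurable_EFinP.
  exact: measurable_indic.
have le_series w : ((Z w `^ beta)%:E <=
    ((2 `^ beta) ^+ N)%:E + \sum_(k <oo) u k w)%E.
  have s0 : (0 <= \sum_(k <oo) u k w)%E by apply: nneseries_ge0 => k _ _.
  have add_series x y : (x <= y -> x <= y + \sum_(k <oo) u k w)%E.
    by move=> xy; apply: le_trans xy _; exact: leeDl.
  have p2 j : (2 `^ beta) ^+ j = (2 ^+ j : R) `^ beta.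
    by rewrite -powR_mulrn ?powR_ge0// -powRrM mulrC powRrM powR_mulrn.
  (* [powR] of a negative base is 1 by convention, which the constant term covers. *)
  have [Zneg|Z0] := ltP (Z w) 0.
    apply: add_series; rewrite lt0_powR1// lee_fin exprn_ege1//.
    by rewrite -[leLHS](powRr0 2) ler_powR ?ler1n// ltW.
  have [ZN|NZ] := leP (Z w) (2 ^+ N).
    apply: add_series; rewrite lee_fin p2 ge0_ler_powR ?nnegrE ?exprn_ge0//; exact: ltW.
  have ex : exists k, Z w <= 2 ^+ k.
    exists (Num.bound `|Z w|); apply: (@le_trans _ _ (Num.bound `|Z w|)%:R).
      by apply: le_trans (ler_norm _) _; apply/ltW/archi_boundP.
    by rewrite -natrX ler_nat ltnW// ltn_expl.
  case: (ex_minnP ex) => m Zm minm.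
  have Nm : (N < m)%N.
    rewrite ltnNge; apply/negP => mN; move: NZ; rewrite ltNge => /negP; apply.
    by apply: le_trans Zm _; rewrite ler_weXn2l// ler1n.
  (* By minimality of [m], [Z w] exceeds [2 ^+ (N + k)], the dyadic level just below [2 ^+ m], so
     the [k]-th term of the series alone dominates. *)
  pose k := (m - N.+1)%N; have kE : (N + k).+1 = m by rewrite /k -addSn subnKC.
  have Zk : 2 ^+ (N + k) < Z w.
    by rewrite ltNge; apply/negP => /minm; rewrite -kE ltnn.
  apply: (@le_trans _ _ (u k w)).
    rewrite lee_fin Zk mulr1 kE p2 ge0_ler_powR ?nnegrE ?exprn_ge0//; exact: ltW.
  apply: (@le_trans _ _ (\sum_(k <oo) u k w)%E); last first.
    by rewrite leeDr// lee_fin exprn_ge0// powR_ge0.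
  apply: le_trans (nneseries_lim_ge k.+1 _) => //.
  by rewrite big_nat_recr//= leeDr// sume_ge0.
apply: (@le_lt_trans _ _ (\int[P]_w (((2 `^ beta) ^+ N)%:E + \sum_(k <oo) u k w))%E).
  apply: ge0_le_integral => //.
  - by move=> w _; rewrite lee_fin powR_ge0.
  - by apply/measurable_EFinP; exact: measurable_RV_powR.
  - by apply: emeasurable_funD => //; exact: ge0_emeasurable_sum.
rewrite ge0_integralD//; last 2 first.
- by move=> w _; apply: nneseries_ge0.
- exact: ge0_emeasurable_sum.
apply: lte_add_pinfty.
  rewrite integral_cst// [X in (_ * X)%E](_ : _ = 1%E); first by rewrite mule1 ltry.
  exact: probability_setT.
rewrite integral_nneseries//.
apply: (@nneseries_geometric_lty _ ((2 `^ beta) ^+ N.+1 * C * (2 `^ (- gamma)) ^+ N)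
   (2 `^ (beta - gamma))).
- by apply: powR2_lt1; rewrite subr_lt0.
- by move=> k; exact: integral_ge0.
move=> k; rewrite uE ge0_integralZl//; last first.
  by apply/measurable_EFinP; exact: measurable_indic.
rewrite integral_indic// setIT.
apply: (@le_trans _ _ (((2 `^ beta) ^+ (N + k).+1)%:E *
    (C * (2 `^ (- gamma)) ^+ (N + k))%:E)%E).
  by rewrite lee_wpmul2l//; apply: tailN; exact: leq_addr.
rewrite -EFinM lee_fin powRD ?pnatr_eq0 ?implybT// exprMn -addSn !exprD.
by rewrite le_eqVlt; apply/orP; left; apply/eqP; ring.
Unshelve. all: by end_near. Qed.

End GeometricBounds.

(** * Choice of the exponents *)

Section Exponents.
Context (R : realType).

(** The lower bounds on [a1], [a2] are the solution of [s1 = 1 + e1 * s2], [s2 = 1 + e2 * s1].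
    Multiplying them by [1 + s] creates a slack [s] in both relations, shared by [theta] and by the
    gap between each [(beta^-1 - 1) / 2] and its [epsilon]. *)
Lemma exists_exponents (alpha1 alpha2 a1 a2 : R) :
  0 < alpha1 -> 0 < alpha2 -> epsilon alpha1 * epsilon alpha2 < 1 ->
  (1 + epsilon alpha1) / (1 - epsilon alpha1 * epsilon alpha2) < a1 ->
  (1 + epsilon alpha2) / (1 - epsilon alpha1 * epsilon alpha2) < a2 ->
  exists beta1 beta2 b1 b2 theta : R,
    [/\ 0 < beta1 <= 1 /\ beta1 < alpha1, 0 < beta2 <= 1 /\ beta2 < alpha2,
        0 < b1 < a1 /\ 0 < b2 < a2, 0 < theta
      & 1 + b2 * ((beta1^-1 - 1) / 2) + theta < b1 /\
        1 + b1 * ((beta2^-1 - 1) / 2) + theta < b2].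
Proof.
move=> al1 al2.
have epsP (al : R) : 0 < al -> 0 <= epsilon al /\ al^-1 <= 1 + 2 * epsilon al.
  move=> al0; rewrite /epsilon; split; first by rewrite le_max lexx orbT.
  have : 2^-1 * (al^-1 - 1) <= Num.max (2^-1 * (al^-1 - 1)) 0.
    by rewrite le_max lexx.
  lra.
have [e10 e1i] := epsP _ al1; have [e20 e2i] := epsP _ al2.
move: (epsilon alpha1) (epsilon alpha2) e10 e1i e20 e2i => e1 e2 e10 e1i e20 e2i.
move=> e12; set D := 1 - e1 * e2; have D0 : 0 < D by rewrite subr_gt0.
set s1 := (1 + e1) / D; set s2 := (1 + e2) / D => s1a s2a.
have s10 : 0 < s1 by rewrite divr_gt0//; lra.
have s20 : 0 < s2 by rewrite divr_gt0//; lra.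
have s1E : s1 = 1 + e1 * s2 by rewrite /s1 /s2 /D; field; rewrite gt_eqF.
have s2E : s2 = 1 + e2 * s1 by rewrite /s1 /s2 /D; field; rewrite gt_eqF.
clearbody s1 s2.
have [s [s0 sa1 sa2]] : exists s, [/\ 0 < s, (1 + s) * s1 < a1 & (1 + s) * s2 < a2].
  (* Half of the smaller relative gap between [a1] and [s1], or [a2] and [s2]. *)
  exists (Num.min ((a1 - s1) / (2 * s1)) ((a2 - s2) / (2 * s2))).
  set s := Num.min _ _.
  have l1 : s <= (a1 - s1) / (2 * s1) by rewrite ge_min lexx.
  have l2 : s <= (a2 - s2) / (2 * s2) by rewrite ge_min lexx orbT.
  rewrite ler_pdivlMr ?mulr_gt0// in l1; rewrite ler_pdivlMr ?mulr_gt0// in l2.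
  split; last 2 first.
  - by rewrite mulrDl mul1r; lra.
  - by rewrite mulrDl mul1r; lra.
  by rewrite lt_min; apply/andP; split; apply: divr_gt0; rewrite ?subr_gt0// mulr_gt0.
pose b1 := (1 + s) * s1; pose b2 := (1 + s) * s2.
have b10 : 0 < b1 by rewrite mulr_gt0//; lra.
have b20 : 0 < b2 by rewrite mulr_gt0//; lra.
(* [sg] is the excess of [(beta^-1 - 1) / 2] over [e1] or [e2]. Its cost, [sg * b2] or [sg * b1],
   stays below [s / 4], and [theta = s / 4] uses another quarter of the slack. *)
pose sg := s / (4 * (b1 + b2)).
have sg0 : 0 < sg by rewrite divr_gt0// mulr_gt0// addr_gt0.
have sgE : sg * b1 + sg * b2 = s / 4.
  by rewrite /sg; field; rewrite gt_eqF// addr_gt0.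
have sgb1 : 0 < sg * b1 by rewrite mulr_gt0.
have sgb2 : 0 < sg * b2 by rewrite mulr_gt0.
have betaP (e al : R) : 0 <= e -> 0 < al -> al^-1 <= 1 + 2 * e ->
   0 < (1 + 2 * (e + sg))^-1 <= 1 /\ (1 + 2 * (e + sg))^-1 < al.
  move=> e0 al0 ei; have p0 : 0 < 1 + 2 * (e + sg) by lra.
  rewrite invr_gt0 p0 invf_le1// ; split; first by lra.
  rewrite -[ltRHS]invrK ltf_pV2 ?posrE ?invr_gt0//; lra.
exists (1 + 2 * (e1 + sg))^-1, (1 + 2 * (e2 + sg))^-1, b1, b2, (s / 4); split.
- exact: betaP.
- exact: betaP.
- by rewrite b10 b20 sa1 sa2.
- by rewrite divr_gt0.
rewrite !invrK.
have h1 : b1 = 1 + s + e1 * b2 by rewrite /b1 /b2 [in LHS]s1E; ring.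
have h2 : b2 = 1 + s + e2 * b1 by rewrite /b1 /b2 [in LHS]s2E; ring.
have -> : (1 + 2 * (e1 + sg) - 1) / 2 = e1 + sg by field.
have -> : (1 + 2 * (e2 + sg) - 1) / 2 = e2 + sg by field.
by rewrite !mulrDr ![_ * e1]mulrC ![_ * e2]mulrC ![_ * sg]mulrC; split; lra.
Qed.

End Exponents.

(** * Truncated means and large conductances in a box *)

Section LargeConductances.
Context (R : realType) (d : measure_display) (T : measurableType d).
Context (P : probability T R).

Lemma clip_expectation (Z : {RV P >-> R}) (beta m M : R) : 0 < M -> 0 < beta <= 1 ->
  (\int[P]_w (Z w `^ beta)%:E <= m%:E)%E ->
  (\int[P]_w (clip M (Z w))%:E <= (M `^ (1 - beta) * m)%:E)%E.
Proof.
move=> M0 b01 Zm.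
have mclip : measurable_fun setT (fun w => (clip M (Z w))%:E).
  apply/measurable_EFinP; apply: (measurableT_comp (measurable_clip _ M)).
  exact: measurable_funPT.
have mpow : measurable_fun setT (fun w => (Z w `^ beta)%:E).
  by apply/measurable_EFinP; exact: measurable_RV_powR.
apply: (@le_trans _ _ ((M `^ (1 - beta))%:E * \int[P]_w (Z w `^ beta)%:E)%E).
  rewrite -ge0_integralZl//; last 2 first.
  - by move=> w _; rewrite lee_fin powR_ge0.
  - by rewrite lee_fin powR_ge0.
  apply: ge0_le_integral => //.
  - by move=> w _; rewrite lee_fin clip_ge0// ltW.
  - exact: measurable_funeM.
  - by move=> w _; rewrite -EFinM lee_fin clip_le_powR.
by rewrite EFinM lee_wpmul2l// lee_fin powR_ge0.
Qed.

(* Dominates the indicator of [Z i > M] for some [i] with [|i| <= n]; the sum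
   counts [i = 0] twice. *)
Definition box_moment (Z : int -> T -> R) (beta M : R) (n : nat) (w : T) : R :=
  M `^ (- beta) * \sum_(j < n.+1) (Z j%:Z w `^ beta + Z (- j%:Z) w `^ beta).

Lemma box_moment_ge0 Z beta M n w : 0 <= box_moment Z beta M n w.
Proof.
by rewrite mulr_ge0 ?powR_ge0// sumr_ge0// => j _; rewrite addr_ge0 ?powR_ge0.
Qed.

Lemma measurable_box_moment (Z : int -> {RV P >-> R}) beta M n :
  measurable_fun setT (box_moment Z beta M n).
Proof.
apply: measurable_funM => //; apply: measurable_sum => j.
by apply: measurable_funD; exact: measurable_RV_powR.
Qed.

Lemma box_moment_lt1 Z beta M n w i : 0 < M -> 0 < beta ->
  (forall k, 0 <= Z k w) -> (`|i| <= n)%N -> box_moment Z beta M n w < 1 -> Z i w <= M.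
Proof.
move=> M0 b0 Z0 iN; apply: contraTT; rewrite -!ltNge -leNgt => MZ.
have Mb0 : 0 < M `^ beta by exact: powR_gt0.
have iN' : (`|i| < n.+1)%N by [].
rewrite /box_moment powRN mulrC ler_pdivlMr// mul1r (bigD1 (Ordinal iN'))//=.
apply: (@le_trans _ _ (Z i w `^ beta)).
  by rewrite ge0_ler_powR ?nnegrE// ltW.
have rest0 : 0 <= \sum_(j < n.+1 | j != Ordinal iN')
    (Z j%:Z w `^ beta + Z (- j%:Z) w `^ beta).
  by apply: sumr_ge0 => j _; rewrite addr_ge0 ?powR_ge0.
rewrite -[leLHS]addr0 lerD//.
have [i0|i0] := leP 0 i.
  by rewrite gez0_abs// lerDl powR_ge0.
by rewrite ltz0_abs// opprK lerDr powR_ge0.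
Qed.

Lemma box_moment_expectation (Z : int -> {RV P >-> R}) beta M n m :
  identically_distributed Z ->
  (\int[P]_w (Z 0%R w `^ beta)%:E <= m%:E)%E ->
  (\int[P]_w (box_moment Z beta M n w)%:E <=
   (M `^ (- beta) * (2 * n.+1%:R * m))%R%:E)%E.
Proof.
move=> idZ Zm.
have mpow i : measurable_fun setT (fun w => (Z i w `^ beta)%:E).
  by apply/measurable_EFinP; exact: measurable_RV_powR.
have p0 i w : (0 <= (Z i w `^ beta)%:E)%E by rewrite lee_fin powR_ge0.
have Zim i : (\int[P]_w (Z i w `^ beta)%:E <= m%:E)%E.
  apply: le_trans Zm; rewrite le_eqVlt; apply/orP; left; apply/eqP.
  apply: (@identically_distributed_integral _ _ _ P int Z i 0
    (fun x => (x `^ beta)%:E)) => //.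
    by apply/measurable_EFinP; exact: measurable_powR.
  by move=> x; rewrite lee_fin powR_ge0.
have -> : (\int[P]_w (box_moment Z beta M n w)%:E =
    \int[P]_w ((M `^ (- beta))%:E * \sum_(j <- index_enum 'I_n.+1)
      ((Z j%:Z w `^ beta)%:E + (Z (- j%:Z)%R w `^ beta)%:E)))%E.
  by apply: eq_integral => w _; rewrite /box_moment EFinM -sumEFin.
rewrite ge0_integralZl//; last 3 first.
- by apply: emeasurable_sum => j; exact: emeasurable_funD.
- by move=> w _; apply: sume_ge0 => j _; rewrite adde_ge0.
- by rewrite lee_fin powR_ge0.
rewrite [leRHS]EFinM lee_wpmul2l//; first by rewrite lee_fin powR_ge0.
rewrite ge0_integral_sum//; last 2 first.
- by move=> j; exact: emeasurable_funD.
- by move=> j w _; rewrite adde_ge0.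
apply: (@le_trans _ _ (\sum_(j <- index_enum 'I_n.+1) (m + m)%:E)%E).
  apply: lee_sum => j _; rewrite (ge0_integralD P measurableT (fun w _ => p0 _ w)
    (mpow _) (fun w _ => p0 _ w) (mpow _)) EFinD.
  by apply: leeD; exact: Zim.
rewrite sumEFin lee_fin sumr_const card_ord -[leLHS]mulr_natl.
by rewrite le_eqVlt; apply/orP; left; apply/eqP; ring.
Qed.

End LargeConductances.
Arguments box_moment {R d T}.

(** * Convergence *)

Section QuenchedLimit.
Context (R : realType).

Lemma cvge0_near_pinfty (f : R -> \bar R) : (forall x, 0 <= f x)%E ->
  (forall e : R, 0 < e -> \forall x \near +oo, (f x <= e%:E)%E) ->
  f x @[x --> +oo] --> 0%R%:E.
Proof.
move=> f0 fe.
have fin e x : (f x <= e%:E)%E -> f x \is a fin_num.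
  by move=> fxe; rewrite ge0_fin_numE// (le_lt_trans fxe)// ltry.
apply/fine_cvgP; split.
  by apply: filterS (fe 1 ltr01) => x; exact: fin.
apply/cvgrPdist_le => e e0; apply: filterS (fe e e0) => x fxe /=.
rewrite sub0r normrN ger0_norm ?fine_ge0//.
by rewrite -lee_fin fineK// (fin _ _ fxe).
Qed.

Lemma exists_dyadic (x : R) : 1 < x -> exists k, x <= 2 ^+ k <= 2 * x.
Proof.
move=> x1.
have ex : exists k, x <= 2 ^+ k.
  exists (Num.bound `|x|); apply: (@le_trans _ _ (Num.bound `|x|)%:R).
    by apply: le_trans (ler_norm _) _; apply/ltW/archi_boundP.
  by rewrite -natrX ler_nat ltnW// ltn_expl.
case: (ex_minnP ex) => -[|k] xk mink; first by move: xk; rewrite leNgt x1.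
exists k.+1; rewrite xk /= exprS ler_pM2l// leNgt; apply/negP => /ltW /mink.
by rewrite ltnn.
Qed.

Context (h v : int -> R) (b1 b2 : R) (M1 M2 : nat -> R) (n : nat -> nat).
Hypotheses (h_gt0 : forall i, 0 < h i) (v_gt0 : forall i, 0 < v i)
  (M1_ge0 : forall k, 0 <= M1 k) (M2_ge0 : forall k, 0 <= M2 k).

Let S k : R := 2 ^+ k.
Let A1 k : R := S k `^ (- b1).
Let A2 k : R := S k `^ (- b2).
Let K k : R := 2 * (M1 k + M2 k).

Hypotheses
  (delta_ge : forall k, 2 * (A1 k * M1 k + A2 k * M2 k) *
     (K k / ((S k)^-1 + K k)) ^+ n k <= (S k)^-1 * (S k)^-1)
  (h_le : \forall k \near \oo, forall i, i%:~R ^+ 2 <= S k `^ b2 -> h i <= M1 k)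
  (v_le : \forall k \near \oo, forall i, i%:~R ^+ 2 <= S k `^ b1 -> v i <= M2 k)
  (potential_cvg0 : barrier_potential h v (M1 k) (M2 k) (K k) (S k)^-1
     (A1 k) (A2 k) (n k) (0, 0) @[k --> \oo] --> (0 : R)).

Context (d : measure_display) (T : measurableType d) (Q : probability T R).
Context (X : R -> T -> int * int).
Hypothesis ctmcX : is_ctmc (line_generator h v) Q (0, 0) X.

(** A time scale [s] is compared with a dyadic [S k] between [s] and [2 * s]. The barrier at scale
    [S k] controls the walk up to time [s * t], and the strict gap [b < a] absorbs the factor 2 and
    the level [eta] once [s] is large. *)
Lemma quenched_limit (f : int * int -> int) (a b t : R) :
  f (0, 0) = 0 -> 0 < b < a -> 0 < t ->
  (forall k x, S k `^ b < (f x)%:~R ^+ 2 ->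
     S k `^ b1 < x.1%:~R ^+ 2 \/ S k `^ b2 < x.2%:~R ^+ 2) ->
  cvg_in_probability0 Q (fun s => sup_abs (rescaled a (fun u w => f (X u w)) s) t).
Proof.
move=> f0 /andP[b0 ba] t0 fB eta eta0.
have S0 k : 0 < S k by rewrite exprn_gt0.
apply: cvge0_near_pinfty => [s|e e0]; first exact: measure_ge0.
have ab0 : 0 < a - b by rewrite subr_gt0.
(* From [k0] on, the conductances in the box are below the truncation levels, and [expR t] times the
   barrier at the origin is at most [e]. *)
have [k0 hk0] : exists k0, forall k, (k0 <= k)%N ->
  [/\ forall i, i%:~R ^+ 2 <= S k `^ b2 -> h i <= M1 k,
      forall i, i%:~R ^+ 2 <= S k `^ b1 -> v i <= M2 k &
      expR t * (barrier_potential h v (M1 k) (M2 k) (K k) (S k)^-1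
        (A1 k) (A2 k) (n k) (0, 0) + (S k)^-1) <= e].
  have lim : expR t * (barrier_potential h v (M1 k) (M2 k) (K k) (S k)^-1
      (A1 k) (A2 k) (n k) (0, 0) + (S k)^-1) @[k --> \oo] --> (0 : R).
    rewrite -[X in _ --> X](mulr0 (expR t)); apply: cvgMr.
    rewrite -[X in _ --> X](addr0 0); apply: cvgD => //.
    under eq_fun do rewrite /S -exprVn.
    by apply: cvg_expr; rewrite ger0_norm ?invr_ge0// invf_lt1// ltr1n.
  have /cvgrPdist_le /(_ _ e0) lime := lim.
  have [k0 _ hk0] : \forall k \near \oo, [/\ forall i, i%:~R ^+ 2 <= S k `^ b2 -> h i <= M1 k,
      forall i, i%:~R ^+ 2 <= S k `^ b1 -> v i <= M2 k &
      expR t * (barrier_potential h v (M1 k) (M2 k) (K k) (S k)^-1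
        (A1 k) (A2 k) (n k) (0, 0) + (S k)^-1) <= e].
    near=> k; split; [by near: k|by near: k|].
    have : `|0 - expR t * (barrier_potential h v (M1 k) (M2 k) (K k) (S k)^-1
        (A1 k) (A2 k) (n k) (0, 0) + (S k)^-1)| <= e by near: k.
    by rewrite sub0r normrN; apply: le_trans; exact: ler_norm.
  by exists k0 => k /hk0.
(* The condition [C <= s ^ (a - b)] amounts to [(2 * s) ^ b <= eta ^ 2 * s ^ a]: a rescaled value
   above [eta] then has its unscaled square above [S k ^ b]. *)
pose C := 2 `^ b / eta ^+ 2.
have C0 : 0 < C by rewrite divr_gt0 ?powR_gt0 ?exprn_gt0.
near=> s.
have Cs : C `^ (a - b)^-1 <= s by near: s; apply: nbhs_pinfty_ge; rewrite num_real.
have s1 : 1 < s by near: s; apply: nbhs_pinfty_gt; rewrite num_real.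
have s0 : 0 < s by exact: lt_trans s1.
have [k /andP[sk k2s]] := exists_dyadic s s1.
have k0k : (k0 <= k)%N.
  have : 2 ^+ k0 < s by near: s; apply: nbhs_pinfty_gt; rewrite num_real.
  by move=> /lt_le_trans /(_ sk); rewrite ltr_eXn2l ?ltr1n// => /ltnW.
have [hB vB expB] := hk0 k k0k.
pose B : set (int * int) :=
  [set x | x.1%:~R ^+ 2 <= S k `^ b1 /\ x.2%:~R ^+ 2 <= S k `^ b2].
(* Both [lambda] and [delta] are [(S k)^-1]; the latter tends to 0 and so does not spoil the exit
   bound. *)
pose g := barrier h v (M1 k) (M2 k) (K k) (S k)^-1 (A1 k) (A2 k) (S k)^-1 (n k).
have A10 : 0 <= A1 k by exact: powR_ge0.
have A20 : 0 <= A2 k by exact: powR_ge0.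
have Si0 : 0 < (S k)^-1 by rewrite invr_gt0.
have g0 x : 0 <= g x.
  exact: (@barrier_ge0 R h v _ _ _ _ _ _ _ _ (M1_ge0 k) (M2_ge0 k)
    (erefl _) Si0 A10 A20 (delta_ge k)).
have pot0 x : 0 <= barrier_potential h v (M1 k) (M2 k) (K k) (S k)^-1 (A1 k) (A2 k) (n k) x.
  exact: (@barrier_potential_ge0 R h v _ _ _ _ _ _ _ (M1_ge0 k) (M2_ge0 k) (erefl _) Si0 A10 A20).
have scale (b' : R) (i : int) : S k `^ b' < i%:~R ^+ 2 -> 1 <= S k `^ (- b') * i%:~R ^+ 2.
  by move=> Si; rewrite powRN mulrC ler_pdivlMr ?powR_gt0// mul1r ltW.
have sq0 (i : int) : 0 <= (i%:~R : R) ^+ 2 by rewrite exprn_even_ge0.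
have g1 x : ~ B x -> 1 <= g x.
  move=> nB; rewrite /g /barrier.
  have rest0 : 0 <= barrier_potential h v (M1 k) (M2 k) (K k) (S k)^-1 (A1 k) (A2 k)
    (n k) x + (S k)^-1 by rewrite addr_ge0// ltW.
  have p1 : 0 <= A1 k * x.1%:~R ^+ 2 by rewrite mulr_ge0.
  have p2 : 0 <= A2 k * x.2%:~R ^+ 2 by rewrite mulr_ge0.
  have [x1|x1] := leP ((x.1%:~R : R) ^+ 2) (S k `^ b1); last first.
    by have := scale _ _ x1; rewrite -/(A1 k); lra.
  have [x2|x2] := leP ((x.2%:~R : R) ^+ 2) (S k `^ b2); last first.
    by have := scale _ _ x2; rewrite -/(A2 k); lra.
  by exfalso; apply: nB.
have gL x : B x -> line_generator h v g x <= (S k)^-1 * g x.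
  move=> [x1 x2].
  apply: (@barrier_super R h v _ _ _ _ _ _ _ _ (M1_ge0 k) (M2_ge0 k)
    (erefl _) Si0 A10 A20 (delta_ge k)).
    by rewrite ltW ?hB.
  by rewrite ltW ?vB.
have fnB x : eta < s `^ (- (a / 2)) * `|(f x)%:~R| -> ~ B x.
  move=> etax [x1 x2].
  have sa0 : 0 < s `^ (a / 2) by exact: powR_gt0.
  have : S k `^ b < (f x)%:~R ^+ 2.
    rewrite powRN mulrC ltr_pdivlMr// in etax.
    apply: (@le_lt_trans _ _ ((eta * s `^ (a / 2)) ^+ 2)); last first.
      rewrite -[ltRHS]real_normK ?num_real// ltr_pXn2r ?nnegrE//.
      by rewrite mulr_ge0// ltW.
    rewrite exprMn -(powR_mulrn 2 (ltW sa0)) -powRrM divfK ?pnatr_eq0//.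
    apply: (@le_trans _ _ ((2 * s) `^ b)).
      by rewrite ge0_ler_powR ?nnegrE ?mulr_ge0// ltW.
    have sE : s `^ a = s `^ (a - b) * s `^ b.
      by rewrite -powRD ?subrK// (gt_eqF s0) implybT.
    rewrite powRM ?(ltW s0)// sE.
    rewrite mulrA ler_pM2r ?powR_gt0// mulrC -ler_pdivrMr ?exprn_gt0// -/C.
    rewrite -[leLHS](powRr1 (ltW C0)) -[X in C `^ X](@mulVf _ (a - b)) ?gt_eqF//.
    rewrite powRrM ge0_ler_powR ?nnegrE ?powR_ge0 ?(ltW s0) ?(ltW ab0)//.
  by move=> /fB[]; rewrite ltNge ?x1 ?x2.
have B0 : B (0, 0) by split; rewrite /= expr0n powR_ge0.
apply: le_trans (@line_sup_prob_le R h v h_gt0 v_gt0 d T Q X ctmcX f B g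
  (S k)^-1 a eta s t f0 eta0 s0 t0 Si0 B0 g0 g1 gL fnB) _.
rewrite lee_fin; apply: le_trans expB.
have -> : g (0, 0) = barrier_potential h v (M1 k) (M2 k) (K k) (S k)^-1
      (A1 k) (A2 k) (n k) (0, 0) + (S k)^-1.
  by rewrite /g /barrier /= expr0n /= !mulr0 !add0r.
rewrite ler_wpM2r ?addr_ge0 ?(ltW Si0)// ler_expR mulrA -[leRHS]mul1r.
by rewrite ler_wpM2r ?(ltW t0)// mulrC ler_pdivrMr// mul1r.
Unshelve. all: by end_near. Qed.

End QuenchedLimit.

(** * Power counting in the scale *)

Section Scales.
Context (R : realType).

Lemma expn_powR (x y : R) k : 0 <= x -> (x ^+ k) `^ y = (x `^ y) ^+ k.
Proof.
by move=> x0; rewrite -powR_mulrn// -powRrM mulrC powRrM powR_mulrn ?powR_ge0.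
Qed.

(** One of the two contributions to the expected potential, with [lambda = S^-1]. The total exponent
    is [(1 + b' * ((beta^-1 - 1) / 2) + theta - b) - theta * beta], whose bracket is negative by
    hypothesis. *)
Lemma scaled_clip_le (S beta b b' theta kappa m : R) : 1 <= S -> 0 <= m ->
  1 + b' * ((beta^-1 - 1) / 2) + theta < b -> beta != 0 -> kappa <= theta * beta ->
  S * (S `^ (- b) * ((S `^ (b' / 2 / beta + theta)) `^ (1 - beta) * m)) <=
  m * S `^ (- kappa).
Proof.
move=> S1 m0 bb' beta0 kb; have S0 : 0 < S by exact: lt_le_trans S1.
have nz x : x ==> (S != 0) by rewrite (gt_eqF S0) implybT.
rewrite !mulrA mulrC ler_wpM2l// -[X in X * _ * _](powRr1 (ltW S0)) -powRrM.
rewrite -!powRD ?nz// ler_powR//.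
have -> : 1 + - b + (b' / 2 / beta + theta) * (1 - beta) =
  (1 + b' * ((beta^-1 - 1) / 2) + theta - b) - theta * beta by field.
by lra.
Qed.

(** The number of lines, of order [S ^ (b' / 2)], cancels against the main part of the level raised
    to [- beta] and leaves [S ^ (- (theta * beta))]. The factor 4 combines the two signs of the
    index with [trunc x + 1 <= 2 * x] for [1 <= x]. *)
Lemma scaled_box_le (S beta b' theta kappa m : R) : 1 <= S -> 0 <= m -> 0 <= b' ->
  beta != 0 -> kappa <= theta * beta ->
  (S `^ (b' / 2 / beta + theta)) `^ (- beta) *
    (2 * (Num.trunc (S `^ (b' / 2))).+1%:R * m) <= 4 * m * S `^ (- kappa).
Proof.
move=> S1 m0 b'0 beta0 kb; have S0 : 0 < S by exact: lt_le_trans S1.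
have nz x : x ==> (S != 0) by rewrite (gt_eqF S0) implybT.
set x := S `^ (b' / 2).
have x1 : 1 <= x by rewrite -[leLHS](powRr0 S) ler_powR// divr_ge0.
have /andP[xn _] : (Num.trunc x)%:R <= x < (Num.trunc x).+1%:R.
  by apply: truncn_itv; exact: le_trans x1.
have n2 : 2 * (Num.trunc x).+1%:R <= 4 * x by rewrite -natr1; lra.
rewrite -powRrM.
apply: (@le_trans _ _ (S `^ ((b' / 2 / beta + theta) * - beta) * (4 * x * m))).
  by rewrite ler_wpM2l ?powR_ge0// ler_wpM2r.
rewrite (_ : _ * _ = 4 * m * (S `^ ((b' / 2 / beta + theta) * - beta) * x)); last by ring.
rewrite ler_wpM2l ?mulr_ge0// /x -powRD ?nz// ler_powR//.
have -> : (b' / 2 / beta + theta) * - beta + b' / 2 = - (theta * beta) by field.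
by rewrite lerN2.
Qed.

Lemma absz_le_truncn (S b : R) (i : int) : i%:~R ^+ 2 <= S `^ b ->
  (`|i| <= Num.trunc (S `^ (b / 2)))%N.
Proof.
move=> iS; have x0 : 0 <= S `^ (b / 2) by exact: powR_ge0.
have /andP[_ xn] := truncn_itv x0.
rewrite -ltnS -(@ltr_nat R); apply: le_lt_trans xn.
rewrite natr_absz intr_norm -(@ler_pXn2r _ 2) ?nnegrE//.
by rewrite real_normK ?num_real// -(powR_mulrn 2 x0) -powRrM divfK ?pnatr_eq0.
Qed.

Lemma ae_forall_int (d : measure_display) (T : measurableType d)
    (P : probability T R) (p : int -> T -> Prop) :
  (forall i, \forall w \ae P, p i w) -> \forall w \ae P, forall i, p i w.
Proof.
move=> ap.
have : \forall w \ae P, forall n : nat, if unpickle n is Some i then p i w else True.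
  apply: ae_foralln => n; case: unpickle => [i|]; first exact: ap.
  exact: nearW.
by apply: filterS => w h i; have := h (pickle i); rewrite pickleK.
Qed.

End Scales.

(** * Truncation levels along the dyadic scales, and passage to almost every environment *)

Theorem proposition3p4 (R : realType) (d : measure_display)
    (Omega : measurableType d) (P : probability Omega R)
    (H V : int -> {RV P >-> R})
    (c alpha1 alpha2 cH cV a1 a2 : R)
    (iidH : iid H) (iidV : iid V) (indepHV : independent_families H V)
    (H_gt0 : forall k : int, \forall w \ae P, 0 < H k w)
    (V_gt0 : forall k : int, \forall w \ae P, 0 < V k w)
    (c_gt0 : 0 < c)
    (H_ge : forall k : int, \forall w \ae P, c <= H k w)
    (V_ge : forall k : int, \forall w \ae P, c <= V k w)
    (alpha1_gt0 : 0 < alpha1) (alpha2_gt0 : 0 < alpha2)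
    (cH_gt0 : 0 < cH) (cV_gt0 : 0 < cV)
    (tailH : regular_tail (H 0) cH alpha1)
    (tailV : regular_tail (V 0) cV alpha2)
    (eps_lt1 : epsilon alpha1 * epsilon alpha2 < 1)
    (a1_gt0 : 0 < a1) (a2_gt0 : 0 < a2)
    (a1_gt : (1 + epsilon alpha1) / (1 - epsilon alpha1 * epsilon alpha2) < a1)
    (a2_gt : (1 + epsilon alpha2) / (1 - epsilon alpha1 * epsilon alpha2) < a2) :
  \forall w \ae P,
    forall (d' : measure_display) (Omega' : measurableType d')
      (Q : probability Omega' R) (X : R -> Omega' -> int * int),
      is_ctmc (line_generator (fun k => H k w) (fun k => V k w)) Q (0, 0) X ->
      forall t : R, 0 < t ->
        cvg_in_probability0 Q
          (fun T => sup_abs (rescaled a1 (fun s w' => (X s w').1) T) t)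
        /\ cvg_in_probability0 Q
          (fun T => sup_abs (rescaled a2 (fun s w' => (X s w').2) T) t).
Proof.
have [beta1 [beta2 [b1 [b2 [theta [[b1P b1al] [b2P b2al] [b1a b2a] theta0 [bb1 bb2]]]]]]] :=
  @exists_exponents R alpha1 alpha2 a1 a2 alpha1_gt0 alpha2_gt0 eps_lt1 a1_gt a2_gt.
have [[be10 be11] [be20 be21]] := (andP b1P, andP b2P).
have [[b10 b1lt] [b20 b2lt]] := (andP b1a, andP b2a).
have moment (Z : {RV P >-> R}) C al be : 0 < be < al -> 0 < C ->
    regular_tail Z C al ->
    exists2 m : R, 0 <= m & (\int[P]_w (Z w `^ be)%:E <= m%:E)%E.
  move=> beal C0 tailZ.
  have fin := @regular_tail_powR_lty R d Omega P Z C al be beal C0 tailZ.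
  have ge0 : (0 <= \int[P]_w (Z w `^ be)%:E)%E.
    by apply: integral_ge0 => w _; rewrite lee_fin powR_ge0.
  exists (fine (\int[P]_w (Z w `^ be)%:E)%E); first exact: fine_ge0.
  by rewrite fineK// ge0_fin_numE.
have [m1 m10 m1P] : exists2 m : R, 0 <= m & (\int[P]_w (H 0%R w `^ beta1)%:E <= m%:E)%E.
  by apply: (moment _ _ alpha1) tailH => //; rewrite be10.
have [m2 m20 m2P] : exists2 m : R, 0 <= m & (\int[P]_w (V 0%R w `^ beta2)%:E <= m%:E)%E.
  by apply: (moment _ _ alpha2) tailV => //; rewrite be20.
(* A common exponent of decay for all error terms; along the dyadic scales they become geometric of
   ratio [q]. *)
pose kappa := Num.min (theta * beta1) (theta * beta2).
have kappa1 : kappa <= theta * beta1 by rewrite ge_min lexx.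
have kappa2 : kappa <= theta * beta2 by rewrite ge_min lexx orbT.
have kappa0 : 0 < kappa by rewrite lt_min !mulr_gt0.
pose q : R := 2 `^ (- kappa).
have q01 : 0 <= q < 1 by apply: powR2_lt1; rewrite oppr_lt0.
pose S k : R := 2 ^+ k.
have S1 k : 1 <= S k by rewrite exprn_ege1// ler1n.
have S0 k : 0 < S k by exact: lt_le_trans (S1 k).
have Sq k : S k `^ (- kappa) = q ^+ k by exact: expn_powR.
pose A1 k := S k `^ (- b1); pose A2 k := S k `^ (- b2).
(* [H] is read at the second coordinate, which the box bounds by [S k ^ (b2 / 2)]: hence [b2] and
   [beta1] in the level for [H], and the reverse for [V]. The margin [theta] makes larger
   conductances in the box improbable. *)
pose M1 k := S k `^ (b2 / 2 / beta1 + theta).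
pose M2 k := S k `^ (b1 / 2 / beta2 + theta).
have A10 k : 0 <= A1 k by exact: powR_ge0.
have A20 k : 0 <= A2 k by exact: powR_ge0.
have M10 k : 0 < M1 k by exact: powR_gt0.
have M20 k : 0 < M2 k by exact: powR_gt0.
have Si0 k : 0 < (S k)^-1 by rewrite invr_gt0.
pose K k := 2 * (M1 k + M2 k).
have K0 k : 0 <= K k by rewrite mulr_ge0// addr_ge0// ltW.
(* The ratio is below 1, so enough Neumann terms push the remainder below [lambda * delta] with
   [lambda = delta = (S k)^-1]. Their number depends on the scale only, not on the environment, as
   the bound on the expected potential requires. *)
have ex_n k : exists n, 2 * (A1 k * M1 k + A2 k * M2 k) *
     (K k / ((S k)^-1 + K k)) ^+ n <= (S k)^-1 * (S k)^-1.
  apply: exists_expr_le; last exact: mulr_gt0.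
  have SK : 0 < (S k)^-1 + K k by rewrite ltr_wpDr.
  by rewrite divr_ge0 ?(ltW SK)//= ltr_pdivrMr// mul1r ltrDr.
have [n nP] := choice ex_n.
pose phi k w := barrier_potential (fun i => H i w) (fun i => V i w)
  (M1 k) (M2 k) (K k) (S k)^-1 (A1 k) (A2 k) (n k) (0, 0).
pose N1 k := Num.trunc (S k `^ (b1 / 2)); pose N2 k := Num.trunc (S k `^ (b2 / 2)).
have phi_cvg0 : \forall w \ae P, phi k w @[k --> \oo] --> (0 : R).
  apply: (@ae_cvg0_of_geometric_expectation R d Omega P phi (2 * (m1 + m2)) q q01).
  - by move=> k; exact: measurable_barrier_potential.
  - move=> k w; exact: (@barrier_potential_ge0 R _ _ _ _ _ _ _ _ _
      (ltW (M10 k)) (ltW (M20 k)) (erefl _) (Si0 k) (A10 k) (A20 k)).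
  move=> k; apply: le_trans (@barrier_potential_expectation R d Omega P H V
    iidH iidV indepHV _ _ _ _ _ _ _ (ltW (M10 k)) (ltW (M20 k)) (erefl _) (Si0 k)
    (A10 k) (A20 k) _ _ (@clip_expectation R d Omega P (H 0) beta1 m1 (M1 k) (M10 k) b1P m1P)
    (@clip_expectation R d Omega P (V 0) beta2 m2 (M2 k) (M20 k) b2P m2P)) _.
  rewrite lee_fin invrK.
  have l1 := @scaled_clip_le R (S k) beta1 b1 b2 theta kappa m1 (S1 k) m10 bb1
    (negbT (gt_eqF be10)) kappa1.
  have l2 := @scaled_clip_le R (S k) beta2 b2 b1 theta kappa m2 (S1 k) m20 bb2
    (negbT (gt_eqF be20)) kappa2.
  rewrite -mulrA -mulrA ler_pM2l// mulrDr mulrDl -Sq.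
  exact: lerD.
have boxH_cvg0 : \forall w \ae P,
    box_moment (fun i => H i) beta1 (M1 k) (N2 k) w @[k --> \oo] --> (0 : R).
  apply: (@ae_cvg0_of_geometric_expectation R d Omega P _ (4 * m1) q q01).
  - by move=> k; exact: measurable_box_moment.
  - by move=> k w; exact: box_moment_ge0.
  move=> k; apply: le_trans (@box_moment_expectation R d Omega P H beta1 (M1 k) (N2 k)
    m1 (proj2 iidH) m1P) _.
  by rewrite lee_fin -Sq; apply: scaled_box_le => //; rewrite ?ltW// gt_eqF.
have boxV_cvg0 : \forall w \ae P,
    box_moment (fun i => V i) beta2 (M2 k) (N1 k) w @[k --> \oo] --> (0 : R).
  apply: (@ae_cvg0_of_geometric_expectation R d Omega P _ (4 * m2) q q01).
  - by move=> k; exact: measurable_box_moment.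
  - by move=> k w; exact: box_moment_ge0.
  move=> k; apply: le_trans (@box_moment_expectation R d Omega P V beta2 (M2 k) (N1 k)
    m2 (proj2 iidV) m2P) _.
  by rewrite lee_fin -Sq; apply: scaled_box_le => //; rewrite ?ltW// gt_eqF.
have posH := @ae_forall_int R d Omega P _ H_gt0; have posV := @ae_forall_int R d Omega P _ V_gt0.
have posHV : \forall w \ae P, (forall i, 0 < H i w) /\ (forall i, 0 < V i w).
  exact: filterI posH posV.
have boxHV_cvg0 : \forall w \ae P,
    (box_moment (fun i => H i) beta1 (M1 k) (N2 k) w @[k --> \oo] --> (0 : R)) /\
    (box_moment (fun i => V i) beta2 (M2 k) (N1 k) w @[k --> \oo] --> (0 : R)).
  exact: filterI boxH_cvg0 boxV_cvg0.
(* A single null set of environments is discarded, before any chain is introduced; from here on [w]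
   is fixed. *)
apply: filterS3 posHV phi_cvg0 boxHV_cvg0 => w [Hw Vw] phi0 [boxH boxV].
move=> d' Omega' Q X ctmcX t t0.
(* The box moment tends to 0, hence is eventually below 1, and from then on no conductance in the
   box exceeds its level. *)
have bounded (Z : int -> {RV P >-> R}) be b (M : nat -> R) :
    0 < be -> (forall k, 0 < M k) -> (forall i, 0 < Z i w) ->
    box_moment (fun i => Z i) be (M k) (Num.trunc (S k `^ (b / 2))) w @[k --> \oo]
      --> (0 : R) ->
    \forall k \near \oo, forall i, i%:~R ^+ 2 <= S k `^ b -> Z i w <= M k.
  move=> be0 M0 Zw /cvgrPdist_lt /(_ 1 ltr01); apply: filterS => k.
  rewrite sub0r normrN ger0_norm ?box_moment_ge0// => box1 i iS.
  have iN := @absz_le_truncn R (S k) b i iS.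
  apply: (@box_moment_lt1 R d Omega (fun j => Z j) be (M k) _ w i (M0 k) be0 _ iN box1).
  by move=> j; exact: ltW.
have h_le := bounded H beta1 b2 M1 be10 M10 Hw boxH.
have v_le := bounded V beta2 b1 M2 be20 M20 Vw boxV.
have limit := @quenched_limit R (fun i => H i w) (fun i => V i w) b1 b2 M1 M2 n
  Hw Vw (fun k => ltW (M10 k)) (fun k => ltW (M20 k)) nP h_le v_le phi0
  d' Omega' Q X ctmcX.
split.
  by apply: (limit (fun x => x.1) a1 b1 t) => // k x; left.
by apply: (limit (fun x => x.2) a2 b2 t) => // k x; right.
Qed.
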